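(* For $n\ge0$ define $$P'_n=\sum_{\sigma\in\mathfrak D_{2n}}x_1^{\mathrm{ereccpeak}'(\sigma)}x_2^{\mathrm{eareccdfall}'(\sigma)}y_1^{\mathrm{eareccval}'(\sigma)}y_2^{\mathrm{ereccdrise}'(\sigma)}u_1^{\mathrm{nrcpeak}'(\sigma)}u_2^{\mathrm{nrcdfall}'(\sigma)}v_1^{\mathrm{nrcval}'(\sigma)}v_2^{\mathrm{nrcdrise}'(\sigma)}w_{\mathrm e}^{\mathrm{evennrfix}(\sigma)}w_{\mathrm o}^{\mathrm{oddnrfix}(\sigma)}z_{\mathrm e}^{\mathrm{evenrar}(\sigma)}z_{\mathrm o}^{\mathrm{oddrar}(\sigma)}$$ $$\times\,p_{-1}^{\mathrm{ucrosscpeak}'(\sigma)}p_{-2}^{\mathrm{lcrosscdfall}'(\sigma)}p_{+1}^{\mathrm{lcrosscval}'(\sigma)}p_{+2}^{\mathrm{ucrosscdrise}'(\sigma)}q_{-1}^{\mathrm{unestcpeak}'(\sigma)}q_{-2}^{\mathrm{lnestcdfall}'(\sigma)}q_{+1}^{\mathrm{lnestcval}'(\sigma)}q_{+2}^{\mathrm{unestcdrise}'(\sigma)}s_{\mathrm e}^{\mathrm{epsnest}(\sigma)}s_{\mathrm o}^{\mathrm{opsnest}(\sigma)}$$ and let $P_n$ be the polynomial $$P_n=\sum_{\sigma\in\mathfrak D_{2n}}x_1^{\mathrm{eareccpeak}(\sigma)}x_2^{\mathrm{eareccdfall}(\sigma)}y_1^{\mathrm{ereccval}(\sigma)}y_2^{\mathrm{ereccdrise}(\sigma)}u_1^{\mathrm{nrcpeak}(\sigma)}u_2^{\mathrm{nrcdfall}(\sigma)}v_1^{\mathrm{nrcval}(\sigma)}v_2^{\mathrm{nrcdrise}(\sigma)}w_{\mathrm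 e}^{\mathrm{evennrfix}(\sigma)}w_{\mathrm o}^{\mathrm{oddnrfix}(\sigma)}z_{\mathrm e}^{\mathrm{evenrar}(\sigma)}z_{\mathrm o}^{\mathrm{oddrar}(\sigma)}$$ $$\times\,p_{-1}^{\mathrm{lcrosscpeak}(\sigma)}p_{-2}^{\mathrm{lcrosscdfall}(\sigma)}p_{+1}^{\mathrm{ucrosscval}(\sigma)}p_{+2}^{\mathrm{ucrosscdrise}(\sigma)}q_{-1}^{\mathrm{lnestcpeak}(\sigma)}q_{-2}^{\mathrm{lnestcdfall}(\sigma)}q_{+1}^{\mathrm{unestcval}(\sigma)}q_{+2}^{\mathrm{unestcdrise}(\sigma)}s_{\mathrm e}^{\mathrm{epsnest}(\sigma)}s_{\mathrm o}^{\mathrm{opsnest}(\sigma)}.$$ Then $\sum_{n\ge0}P'_nt^n$ equals the T-type continued fraction with coefficients $\alpha_{2k-1}=\bigl(p_{-1}^{k-1}x_1+q_{-1}[k-1]_{p_{-1},q_{-1}}u_1\bigr)\bigl(p_{+1}^{k-1}y_1+q_{+1}[k-1]_{p_{+1},q_{+1}}v_1\bigr)$, $\alpha_{2k}=\bigl(p_{-2}^{k-1}x_2+q_{-2}[k-1]_{p_{-2},q_{-2}}u_2+s_{\mathrm e}^kw_{\mathrm e}\bigr)\bigl(p_{+2}^{k-1}y_2+q_{+2}[k-1]_{p_{+2},q_{+2}}v_2+s_{\mathrm o}^kw_{\mathrm o}\bigr)$ ($k\ge1$), $\delta_1=z_{\mathrm e}z_{\mathrm o}$, $\delta_n=0$ ($n\ge2$);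 consequently $P_n=P'_n$ for all $n\ge0$.
   Context: $\mathfrak D_{2n}$: permutations $\sigma$ of $[2n]$ with $\sigma(2k-1)\ge2k-1$, $\sigma(2k)\le2k$ for all $k\in[n]$. Index $i$ is a cycle peak / valley / double rise / double fall if respectively $\sigma^{-1}(i)<i>\sigma(i)$ / $\sigma^{-1}(i)>i<\sigma(i)$ / $\sigma^{-1}(i)<i<\sigma(i)$ / $\sigma^{-1}(i)>i>\sigma(i)$. Record: $\sigma(j)<\sigma(i)$ for all $j<i$; antirecord: $\sigma(j)>\sigma(i)$ for all $j>i$; exclusive record = record not antirecord; exclusive antirecord = antirecord not record; record-antirecord = both; neither-record-antirecord = neither. Unprimed record statistics: $\mathrm{eareccpeak},\mathrm{eareccdfall}$ = number of exclusive antirecords that are cycle peaks, resp. cycle double falls; $\mathrm{ereccval},\mathrm{ereccdrise}$ = exclusive records that are cycle valleys, resp. cycle double rises; $\mathrm{nrcpeak},\mathrm{nrcdfall},\mathrm{nrcval},\mathrm{nrcdrise}$ = neither-record-antirecords that are cycle peaks, double falls, valleys, double rises. Primed record statistics: $\mathrm{ereccpeak}'(\sigma)$ (resp. $\mathrm{nrcpeak}'$) = number of cycle peaks $i$ such that $\sigma^{-1}(i)$ is (resp. is not) a record; $\mathrm{ereccdrise}'$ (resp. $\mathrm{nrcdrise}'$) = cycle double rises $i$ with $\sigma^{-1}(i)$ a record (resp. not a record); $\mathrm{eareccval}'$ (resp. $\mathrm{nrcval}'$) = cycle valleys $i$ with $\sigma^{-1}(i)$ an antirecord (resp. not an antirecord);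 $\mathrm{eareccdfall}'$ (resp. $\mathrm{nrcdfall}'$) = cycle double falls $i$ with $\sigma^{-1}(i)$ an antirecord (resp. not). $\mathrm{evennrfix},\mathrm{oddnrfix}$ = even/odd fixed points that are neither-record-antirecords; $\mathrm{evenrar},\mathrm{oddrar}$ = even/odd record-antirecords. Crossing/nesting: $\mathrm{ucross}(j,\sigma)=\#\{(i,k,l):i<j<k<l,k=\sigma(i),l=\sigma(j)\}$, $\mathrm{unest}(j,\sigma)=\#\{(i,k,l):i<j<k<l,k=\sigma(j),l=\sigma(i)\}$, $\mathrm{lcross}(k,\sigma)=\#\{(i,j,l):i<j<k<l,i=\sigma(k),j=\sigma(l)\}$, $\mathrm{lnest}(k,\sigma)=\#\{(i,j,l):i<j<k<l,i=\sigma(l),j=\sigma(k)\}$; $\mathrm{ucross}'(k,\sigma)=\#\{(i,j,l):i<j<k<l,k=\sigma(i),l=\sigma(j)\}$, $\mathrm{unest}'(k,\sigma)=\#\{(i,j,l):i<j<k<l,k=\sigma(j),l=\sigma(i)\}$, $\mathrm{lcross}'(j,\sigma)=\#\{(i,k,l):i<j<k<l,i=\sigma(k),j=\sigma(l)\}$, $\mathrm{lnest}'(j,\sigma)=\#\{(i,k,l):i<j<k<l,i=\sigma(l),j=\sigma(k)\}$. Sums: $\mathrm{ucrosscval}=\sum_{\text{cycle valleys }j}\mathrm{ucross}(j,\sigma)$, $\mathrm{ucrosscdrise}=\sum_{\text{cycle double rises }j}\mathrm{ucross}(j,\sigma)$, $\mathrm{lcrosscpeak}=\sum_{\text{cycle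 peaks }k}\mathrm{lcross}(k,\sigma)$, $\mathrm{lcrosscdfall}=\sum_{\text{cycle double falls }k}\mathrm{lcross}(k,\sigma)$, and similarly the nest versions; $\mathrm{ucrosscpeak}'=\sum_{\text{cycle peaks }k}\mathrm{ucross}'(k,\sigma)$, $\mathrm{unestcpeak}'=\sum_{\text{cycle peaks }k}\mathrm{unest}'(k,\sigma)$, $\mathrm{ucrosscdrise}',\mathrm{unestcdrise}'$ = same sums over cycle double rises, $\mathrm{lcrosscval}',\mathrm{lnestcval}'$ = sums of $\mathrm{lcross}',\mathrm{lnest}'$ over cycle valleys, $\mathrm{lcrosscdfall}',\mathrm{lnestcdfall}'$ = same over cycle double falls. For a fixed point $j$, $\mathrm{psnest}(j,\sigma)=\#\{i<j:\sigma(i)>j\}$; $\mathrm{epsnest},\mathrm{opsnest}$ = sums of psnest over even, resp. odd, fixed points. $[n]_{p,q}=\sum_{j=0}^{n-1}p^jq^{n-1-j}$. T-type continued fraction with coefficients $(\alpha_n),(\delta_n)$: $1/(1-\delta_1t-\alpha_1t/(1-\delta_2t-\alpha_2t/(1-\delta_3t-\cdots)))$. *)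

(* Defs.v *)
From HB Require Import structures.
From mathcomp Require Import all_boot all_order all_algebra all_fingroup.
From mathcomp Require Import mpoly.

Set Implicit Arguments.
Unset Strict Implicit.
Unset Printing Implicit Defensive.

Import GRing.Theory.

(** * Permutation statistics

    The element [i : 'I_N] stands for the index [i.+1] of {1, ..., N}.  Only
    parity is sensitive to this shift. *)

Section Statistics.

Variable N : nat.
Implicit Types (s : 'S_N) (i j k l : 'I_N).

Definition oddidx i : bool := odd i.+1.
Definition evenidx i : bool := ~~ odd i.+1.

(* sigma(2k-1) >= 2k-1 and sigma(2k) <= 2k; used with N = 2n. *)
Definition Dperm s : bool :=
  [forall i, (oddidx i ==> (i <= s i)) && (evenidx i ==> (s i <= i))].

Definition cpeak s i : bool := ((s^-1)%g i < i) && (s i < i).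
Definition cval s i : bool := (i < (s^-1)%g i) && (i < s i).
Definition cdrise s i : bool := ((s^-1)%g i < i) && (i < s i).
Definition cdfall s i : bool := (i < (s^-1)%g i) && (s i < i).
Definition fixpt s i : bool := s i == i.

Definition record s i : bool := [forall j : 'I_N, (j < i) ==> (s j < s i)].
Definition antirecord s i : bool := [forall j : 'I_N, (i < j) ==> (s i < s j)].
Definition erec s i : bool := record s i && ~~ antirecord s i.
Definition earec s i : bool := antirecord s i && ~~ record s i.
Definition rar s i : bool := record s i && antirecord s i.
Definition nrar s i : bool := ~~ record s i && ~~ antirecord s i.

Definition eareccpeak s := #|[set i | earec s i && cpeak s i]|.
Definition eareccdfall s := #|[set i | earec s i && cdfall s i]|.
Definition ereccval s := #|[set i | erec s i && cval s i]|.
Definition ereccdrise s := #|[set i | erec s i && cdrise s i]|.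
Definition nrcpeak s := #|[set i | nrar s i && cpeak s i]|.
Definition nrcdfall s := #|[set i | nrar s i && cdfall s i]|.
Definition nrcval s := #|[set i | nrar s i && cval s i]|.
Definition nrcdrise s := #|[set i | nrar s i && cdrise s i]|.

Definition ereccpeak' s := #|[set i | cpeak s i && record s ((s^-1)%g i)]|.
Definition nrcpeak' s := #|[set i | cpeak s i && ~~ record s ((s^-1)%g i)]|.
Definition ereccdrise' s := #|[set i | cdrise s i && record s ((s^-1)%g i)]|.
Definition nrcdrise' s := #|[set i | cdrise s i && ~~ record s ((s^-1)%g i)]|.
Definition eareccval' s := #|[set i | cval s i && antirecord s ((s^-1)%g i)]|.
Definition nrcval' s := #|[set i | cval s i && ~~ antirecord s ((s^-1)%g i)]|.
Definition eareccdfall' s :=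
  #|[set i | cdfall s i && antirecord s ((s^-1)%g i)]|.
Definition nrcdfall' s :=
  #|[set i | cdfall s i && ~~ antirecord s ((s^-1)%g i)]|.

Definition evennrfix s := #|[set i | [&& evenidx i, fixpt s i & nrar s i]]|.
Definition oddnrfix s := #|[set i | [&& oddidx i, fixpt s i & nrar s i]]|.
Definition evenrar s := #|[set i | evenidx i && rar s i]|.
Definition oddrar s := #|[set i | oddidx i && rar s i]|.

Definition ucross j s := #|[set x : 'I_N * 'I_N * 'I_N | let: (i, k, l) := x in
  [&& i < j, j < k, k < l, k == s i & l == s j]]|.
Definition unest j s := #|[set x : 'I_N * 'I_N * 'I_N | let: (i, k, l) := x in
  [&& i < j, j < k, k < l, k == s j & l == s i]]|.
Definition lcross k s := #|[set x : 'I_N * 'I_N * 'I_N | let: (i, j, l) := x in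
  [&& i < j, j < k, k < l, i == s k & j == s l]]|.
Definition lnest k s := #|[set x : 'I_N * 'I_N * 'I_N | let: (i, j, l) := x in
  [&& i < j, j < k, k < l, i == s l & j == s k]]|.

Definition ucross' k s := #|[set x : 'I_N * 'I_N * 'I_N | let: (i, j, l) := x in
  [&& i < j, j < k, k < l, k == s i & l == s j]]|.
Definition unest' k s := #|[set x : 'I_N * 'I_N * 'I_N | let: (i, j, l) := x in
  [&& i < j, j < k, k < l, k == s j & l == s i]]|.
Definition lcross' j s := #|[set x : 'I_N * 'I_N * 'I_N | let: (i, k, l) := x in
  [&& i < j, j < k, k < l, i == s k & j == s l]]|.
Definition lnest' j s := #|[set x : 'I_N * 'I_N * 'I_N | let: (i, k, l) := x in
  [&& i < j, j < k, k < l, i == s l & j == s k]]|.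

Definition ucrosscval s := \sum_(j | cval s j) ucross j s.
Definition ucrosscdrise s := \sum_(j | cdrise s j) ucross j s.
Definition unestcval s := \sum_(j | cval s j) unest j s.
Definition unestcdrise s := \sum_(j | cdrise s j) unest j s.
Definition lcrosscpeak s := \sum_(k | cpeak s k) lcross k s.
Definition lcrosscdfall s := \sum_(k | cdfall s k) lcross k s.
Definition lnestcpeak s := \sum_(k | cpeak s k) lnest k s.
Definition lnestcdfall s := \sum_(k | cdfall s k) lnest k s.

Definition ucrosscpeak' s := \sum_(k | cpeak s k) ucross' k s.
Definition unestcpeak' s := \sum_(k | cpeak s k) unest' k s.
Definition ucrosscdrise' s := \sum_(k | cdrise s k) ucross' k s.
Definition unestcdrise' s := \sum_(k | cdrise s k) unest' k s.
Definition lcrosscval' s := \sum_(j | cval s j) lcross' j s.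
Definition lnestcval' s := \sum_(j | cval s j) lnest' j s.
Definition lcrosscdfall' s := \sum_(j | cdfall s j) lcross' j s.
Definition lnestcdfall' s := \sum_(j | cdfall s j) lnest' j s.

Definition psnest j s := #|[set i : 'I_N | (i < j) && (j < s i)]|.
Definition epsnest s := \sum_(j | evenidx j && fixpt s j) psnest j s.
Definition opsnest s := \sum_(j | oddidx j && fixpt s j) psnest j s.

End Statistics.

Local Open Scope ring_scope.

(** * Formal power series and T-type continued fractions

    The series sum_n f_n t^n is represented by its coefficient sequence f. *)

Section Tfrac.

Variable R : comNzRingType.
Implicit Types (f g : nat -> R) (c : R).

Definition fps_const c : nat -> R := fun n => if n is 0%N then c else 0.
Definition fps_add f g : nat -> R := fun n => f n + g n.
Definition fps_opp f : nat -> R := fun n => - f n.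
Definition fps_sub f g : nat -> R := fps_add f (fps_opp g).
Definition fps_mul f g : nat -> R := fun n => \sum_(i < n.+1) f i * g (n - i)%N.
Definition fps_t : nat -> R := fun n => (n == 1)%:R.

(* The first n coefficients of 1/f, when f has constant term 1. *)
Fixpoint fps_inv_seq f (n : nat) : seq R :=
  if n is n'.+1 then
    let h := fps_inv_seq f n' in
    rcons h ((n' == 0)%:R - \sum_(i < n') h`_i * f (n' - i)%N)
  else [::].

Definition fps_inv f : nat -> R := fun n => (fps_inv_seq f n.+1)`_n.

Lemma size_fps_inv_seq f n : size (fps_inv_seq f n) = n.
Proof. by elim: n => //= n IHn; rewrite size_rcons IHn. Qed.

Lemma nth_fps_inv_seq f n i : (i < n)%N -> (fps_inv_seq f n)`_i = fps_inv f i.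
Proof.
elim: n => // n IHn; rewrite ltnS leq_eqVlt => /predU1P[-> //|lt_in] /=.
by rewrite nth_rcons size_fps_inv_seq lt_in IHn.
Qed.

Lemma fps_invP f : f 0%N = 1 -> fps_mul (fps_inv f) f =1 fps_const 1.
Proof.
move=> f0 n; rewrite /fps_mul big_ord_recr /= subnn f0 mulr1.
rewrite [fps_inv f n]/fps_inv /= nth_rcons size_fps_inv_seq ltnn eqxx.
under eq_bigr => i _ do rewrite -(@nth_fps_inv_seq f n) //.
by rewrite addrC subrK; case: n.
Qed.

(* 1/(1 - delta_j t - alpha_j t/( ... /(1 - delta_(j+K-1) t))), with K levels. *)
Fixpoint tfrac_trunc (alpha delta : nat -> R) (K j : nat) : nat -> R :=
  if K is K'.+1 then
    fps_inv
      (fps_sub (fps_sub (fps_const 1) (fps_mul (fps_const (delta j)) fps_t))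
               (fps_mul (fps_mul (fps_const (alpha j)) fps_t)
                        (tfrac_trunc alpha delta K' j.+1)))
  else fps_const 0.

(* f is the infinite continued fraction with coefficients (alpha_n)_(n >= 1) and
   (delta_n)_(n >= 1), i.e., the t-adic limit of the truncations.  The entries
   alpha_0 and delta_0 are not used. *)
Definition is_tfrac (alpha delta : nat -> R) f : Prop :=
  forall n, exists K0, forall K, (K0 <= K)%N ->
    tfrac_trunc alpha delta K 1 n = f n.

Definition pqint (n : nat) (p q : R) : R := \sum_(j < n) p ^+ j * q ^+ (n.-1 - j).

End Tfrac.

(** * The generating polynomials *)

(* p_{-1}, p_{-2}, p_{+1}, p_{+2} are written pm1, pm2, pp1, pp2, and similarly
   for q. *)
Local Notation poly22 := {mpoly int[22]}.
Local Notation var k := ('X_(@Ordinal 22 k isT) : poly22).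

Definition x1 : poly22 := var 0.
Definition x2 : poly22 := var 1.
Definition y1 : poly22 := var 2.
Definition y2 : poly22 := var 3.
Definition u1 : poly22 := var 4.
Definition u2 : poly22 := var 5.
Definition v1 : poly22 := var 6.
Definition v2 : poly22 := var 7.
Definition we : poly22 := var 8.
Definition wo : poly22 := var 9.
Definition ze : poly22 := var 10.
Definition zo : poly22 := var 11.
Definition pm1 : poly22 := var 12.
Definition pm2 : poly22 := var 13.
Definition pp1 : poly22 := var 14.
Definition pp2 : poly22 := var 15.
Definition qm1 : poly22 := var 16.
Definition qm2 : poly22 := var 17.
Definition qp1 : poly22 := var 18.
Definition qp2 : poly22 := var 19.
Definition se : poly22 := var 20.
Definition so : poly22 := var 21.

Definition P (n : nat) : poly22 :=
  \sum_(s : 'S_(2 * n) | Dperm s)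
    (x1 ^+ eareccpeak s * x2 ^+ eareccdfall s *
     y1 ^+ ereccval s * y2 ^+ ereccdrise s *
     u1 ^+ nrcpeak s * u2 ^+ nrcdfall s *
     v1 ^+ nrcval s * v2 ^+ nrcdrise s *
     we ^+ evennrfix s * wo ^+ oddnrfix s *
     ze ^+ evenrar s * zo ^+ oddrar s *
     pm1 ^+ lcrosscpeak s * pm2 ^+ lcrosscdfall s *
     pp1 ^+ ucrosscval s * pp2 ^+ ucrosscdrise s *
     qm1 ^+ lnestcpeak s * qm2 ^+ lnestcdfall s *
     qp1 ^+ unestcval s * qp2 ^+ unestcdrise s *
     se ^+ epsnest s * so ^+ opsnest s).

Definition P' (n : nat) : poly22 :=
  \sum_(s : 'S_(2 * n) | Dperm s)
    (x1 ^+ ereccpeak' s * x2 ^+ eareccdfall' s *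
     y1 ^+ eareccval' s * y2 ^+ ereccdrise' s *
     u1 ^+ nrcpeak' s * u2 ^+ nrcdfall' s *
     v1 ^+ nrcval' s * v2 ^+ nrcdrise' s *
     we ^+ evennrfix s * wo ^+ oddnrfix s *
     ze ^+ evenrar s * zo ^+ oddrar s *
     pm1 ^+ ucrosscpeak' s * pm2 ^+ lcrosscdfall' s *
     pp1 ^+ lcrosscval' s * pp2 ^+ ucrosscdrise' s *
     qm1 ^+ unestcpeak' s * qm2 ^+ lnestcdfall' s *
     qp1 ^+ lnestcval' s * qp2 ^+ unestcdrise' s *
     se ^+ epsnest s * so ^+ opsnest s).

(* alpha_(2k-1) and alpha_(2k), as functions of k. *)
Definition alpha_odd (k : nat) : poly22 :=
  (pm1 ^+ k.-1 * x1 + qm1 * pqint k.-1 pm1 qm1 * u1) *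
  (pp1 ^+ k.-1 * y1 + qp1 * pqint k.-1 pp1 qp1 * v1).

Definition alpha_even (k : nat) : poly22 :=
  (pm2 ^+ k.-1 * x2 + qm2 * pqint k.-1 pm2 qm2 * u2 + se ^+ k * we) *
  (pp2 ^+ k.-1 * y2 + qp2 * pqint k.-1 pp2 qp2 * v2 + so ^+ k * wo).

(* uphalf m = k both for m = 2k-1 and for m = 2k. *)
Definition alpha (m : nat) : poly22 :=
  if odd m then alpha_odd (uphalf m) else alpha_even (uphalf m).

Definition delta (n : nat) : poly22 := if n == 1%N then ze * zo else 0.

(* Main.v *)
(** Read a D-permutation s as the word of the cycle types of its indices;
    this word determines the diagonal side of s b and s^-1 b at each index
    b. Fixing the word, choose s b in increasing order of b for the arcs
    below the diagonal and in decreasing order of b for those above it: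
    the number k of available values does not depend on the previous
    choices, the rank r of s b among them is the nesting number at b, the
    crossing number is k - 1 - r, and r = 0 characterizes (anti)records.
    Hence the sum over the permutations with a given word is a product of
    local factors. The primed statistics of s are the unprimed ones of
    s^-1, for which the same argument gives the same local factors. Both
    polynomials are thus the same weighted sum over paths; splitting a
    path from height H to 0 at its first visits of the lower heights gives
    the continued fraction. *)
Require Import Defs.
From mathcomp Require Import all_boot all_order all_algebra all_fingroup.
From mathcomp Require Import mpoly.
From mathcomp Require Import zify ring.

Set Implicit Arguments.
Unset Strict Implicit.
Unset Printing Implicit Defensive.

Import GRing.Theory.

Local Open Scope ring_scope.

(** * Permutations with prescribed sets of values *)

Section RankSum.

Variables (R : comNzRingType) (T : finType) (lt : rel T).
Hypotheses (ltxx : irreflexive lt) (lt_trans : transitive lt).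
Hypothesis lt_total : forall x y, x != y -> lt x y || lt y x.

(** Ranks increase strictly along [lt] and stay below [#|A|], so they are injective on [A] and fill
    all values by cardinality. *)
Lemma sum_over_ranks (A : {set T}) (g : nat -> R) :
  \sum_(a in A) g #|[set x in A | lt x a]| = \sum_(r < #|A|) g r.
Proof.
have rank_lt a b : a \in A -> lt a b ->
    (#|[set x in A | lt x a]| < #|[set x in A | lt x b]|)%N.
  move=> Aa ab; apply: proper_card; apply/properP; split.
    by apply/subsetP=> x; rewrite !inE => /andP[-> /lt_trans->].
  by exists a; rewrite !inE Aa ?ab // ltxx.
have rank_bound a : a \in A -> (#|[set x in A | lt x a]| < #|A|)%N.
  move=> Aa; apply: proper_card; apply/properP; split.
    by apply/subsetP=> x; rewrite !inE => /andP[].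
  by exists a; rewrite // !inE Aa ltxx.
case DA: #|A| => [|n].
  by rewrite big_ord0 (cards0_eq DA) big_set0.
pose rk a : 'I_n.+1 := inord #|[set x in A | lt x a]|.
have rkE a : a \in A -> rk a = #|[set x in A | lt x a]| :> nat.
  by move=> Aa; rewrite inordK // -DA rank_bound.
have rk_inj : {in A &, injective rk}.
  move=> a b Aa Ab /(congr1 val) /=; rewrite !rkE // => eq_rk.
  apply/eqP; apply: contraT => /lt_total/orP[]/rank_lt.
    by move/(_ Aa); rewrite eq_rk ltnn.
  by move/(_ Ab); rewrite eq_rk ltnn.
have -> : \sum_(r < n.+1) g r = \sum_(r in rk @: A) g r.
  apply: eq_bigl => r; apply/esym; suff -> : rk @: A = setT by rewrite inE.
  by apply/eqP; rewrite eqEcard subsetT card_in_imset // cardsT card_ord DA /=.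
by rewrite big_imset //=; apply: eq_bigr => a Aa; rewrite rkE.
Qed.

End RankSum.

(** * Filling positions one at a time *)

Section BoardSum.

Variables (R : comNzRingType) (T : finType) (pos : T -> nat).
Variables (cand : T -> {set T}) (low : rel T) (lt : T -> rel T).
Variable f : T -> nat -> R.

Hypothesis pos_inj : injective pos.
(** An earlier candidate set is contained in a later one or disjoint from it, so the number of
    candidates already taken at [b] does not depend on the choices made. *)
Hypothesis candP : forall b' b a,
  (pos b' < pos b)%N -> a \in cand b' -> (a \in cand b) = low b' b.
Hypothesis ltxx : forall b, irreflexive (lt b).
Hypothesis lt_trans : forall b, transitive (lt b).
Hypothesis lt_total : forall b x y, x != y -> lt b x y || lt b y x.

(** [p b] is compared only with the values given to later positions: these are still free when [b]
    is treated. *)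
Definition rank (p : {perm T}) b :=
  #|[set a in cand b | lt b a (p b) && (pos b < pos ((p^-1)%g a))%N]|.
Definition room b :=
  (#|cand b| - #|[set b' | (pos b' < pos b)%N && low b' b]|)%N.

(** [rho] holds the choices made before position [n]. The choice at [n] splits off one factor and
    leaves a sum of the same form with [rho] extended. *)
Lemma sum_perm_extending n (rho : T -> T) :
    (forall b, (pos b < n)%N -> rho b \in cand b) ->
    {in [pred b | (pos b < n)%N] &, injective rho} ->
  \sum_(p : {perm T} |
      [forall b, if (pos b < n)%N then p b == rho b else p b \in cand b])
     \prod_(b | (n <= pos b)%N) f b (rank p b) =
  \prod_(b | (n <= pos b)%N) \sum_(r < room b) f b r.
Proof.
pose M := (\max_b pos b).+1.
have posM b : (pos b < M)%N by rewrite ltnS leq_bigmax.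
have [m] := ubnP (M - n)%N.
elim: m n rho => // m IHm n rho lt_m rho_cand rho_inj.
have [leMn|ltnM] := leqP M n.
  have posn b : (pos b < n)%N by apply: leq_trans leMn.
  have injr : injective rho by move=> x y; apply: rho_inj; rewrite !inE.
  rewrite (eq_bigl (pred1 (perm injr))); last first.
    move=> p; apply/forallP/eqP => [rhoP|-> b]; last by rewrite posn permE.
    by apply/permP=> b; move: (rhoP b); rewrite posn permE => /eqP.
  have posF b : (n <= pos b)%N = false by rewrite leqNgt posn.
  by rewrite big_pred1_eq !(eq_bigl _ _ posF) !big_pred0_eq.
have ltSm : (M - n.+1 < m)%N by lia.
(* Positions need not be consecutive: if none equals [n], the claims for [n] and [n.+1] coincide. *)
have [b0 /eqP pos0|no_pos] := pickP [pred b | pos b == n]; last first.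
  have posE b : (n <= pos b)%N = (n.+1 <= pos b)%N.
    by rewrite leq_eqVlt eq_sym -[_ == n]/([pred b | pos b == n] b) no_pos.
  have posE' b : (pos b < n)%N = (pos b < n.+1)%N 
    by rewrite ltnNge posE -leqNgt ltnS.
  have predE (p : {perm T}) :
      [forall b, if (pos b < n)%N then p b == rho b else p b \in cand b] =
      [forall b, if (pos b < n.+1)%N then p b == rho b else p b \in cand b].
    by apply: eq_forallb => b; rewrite posE'.
  rewrite (eq_bigl _ _ predE) (eq_bigl _ _ posE).
  under eq_bigr => p _ do rewrite (eq_bigl _ _ posE).
  apply: IHm => // [b|x y]; rewrite -?posE'; first exact: rho_cand.
  by rewrite !inE -!posE'; apply: rho_inj; rewrite inE.
have posS b : (n.+1 <= pos b)%N = (n <= pos b)%N && (b != b0).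
  by rewrite -(inj_eq pos_inj) pos0 ltn_neqAle andbC eq_sym.
pose used := rho @: [set b | (pos b < n)%N].
pose avail := cand b0 :\: used.
have card_avail : #|avail| = room b0.
  rewrite cardsD /room; congr (_ - _)%N.
  have -> : cand b0 :&: used =
      rho @: [set b' | (pos b' < pos b0)%N && low b' b0].
    apply/setP=> a; rewrite inE; apply/andP/imsetP=> [[ca /imsetP[b]]|[b]].
      rewrite inE => ltb Da; exists b; rewrite // inE pos0 ltb /=.
      by rewrite -(candP (a := rho b)) ?pos0 // ?rho_cand // -Da.
    rewrite inE pos0 => /andP[ltb lowb] ->.
    rewrite (@candP b) ?pos0 ?rho_cand //; split=> //.
    by rewrite imset_f // inE.
  apply: card_in_imset => x y; rewrite !inE pos0 => /andP[ltx _] /andP[lty _].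
  by apply: rho_inj; rewrite inE.
rewrite (bigD1 b0) ?pos0 //= -card_avail.
rewrite -(sum_over_ranks (ltxx b0) (@lt_trans b0) (@lt_total b0)).
rewrite (partition_big (fun p : {perm T} => p b0) (mem avail)) /=; last first.
  move=> p /forallP rhoP; rewrite !inE.
  have := rhoP b0; rewrite pos0 ltnn => ->; rewrite andbT.
  apply/imsetP=> [[b]]; rewrite inE => ltb.
  move: (rhoP b); rewrite ltb => /eqP <- /perm_inj eqb.
  by move: ltb; rewrite -eqb pos0 ltnn.
rewrite big_distrl /=; apply: eq_bigr => a avail_a.
have [cand_a unused_a] : a \in cand b0 /\ a \notin used.
  by move: avail_a; rewrite inE => /andP[].
pose rho' b := if b == b0 then a else rho b.
have rho'_old b : (pos b < n)%N -> rho' b = rho b.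
  by rewrite /rho'; case: eqP => // ->; rewrite pos0 ltnn.
have posS' b : (pos b < n.+1)%N = (pos b < n)%N || (b == b0).
  by rewrite ltnS leq_eqVlt -{1}pos0 (inj_eq pos_inj) orbC.
have QE (p : {perm T}) :
  [forall b, if (pos b < n)%N then p b == rho b else p b \in cand b] &&
      (p b0 == a) =
  [forall b, if (pos b < n.+1)%N then p b == rho' b else p b \in cand b].
  apply/andP/forallP => [[/forallP rhoP /eqP pb0] b|rhoP].
    rewrite posS' /rho'; have := rhoP b; case: (b =P b0) => [->|_].
      by rewrite pos0 ltnn orbT pb0.
    by rewrite orbF.
  split; last by have := rhoP b0; rewrite posS' eqxx orbT /rho' eqxx.
  apply/forallP=> b; have := rhoP b; rewrite posS' /rho'.
  case: (b =P b0) => [->|_]; last by rewrite orbF.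
  rewrite pos0 ltnn orbT => /eqP ->.
  exact: cand_a.
(* Once [p b0 = a], the later values are those neither used nor equal to [a], so the rank at [b0] is
   that of [a] in [avail], whatever the rest of [p]. *)
transitivity (\sum_(p : {perm T} | [forall b,
    if (pos b < n.+1)%N then p b == rho' b else p b \in cand b])
   f b0 #|[set x in avail | lt b0 x a]| *
     \prod_(b | (n.+1 <= pos b)%N) f b (rank p b)).
  apply: eq_big => [p|p /andP[/forallP rhoP /eqP pb0]]; first exact: QE.
  rewrite (bigD1 b0) ?pos0 //=; congr (f b0 _ * _); last first.
    by apply: eq_bigl => b; rewrite posS.
  apply: eq_card => x; rewrite !inE pb0 -andbA [RHS]andbC -andbA.
  congr andb; apply: andb_id2l => ltx.
  have -> : (pos b0 < pos ((p^-1)%g x))%N = ~~ (pos ((p^-1)%g x) < n.+1)%N.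
    by rewrite pos0 ltnNge.
  rewrite posS' negb_or.
  have -> : (p^-1)%g x != b0.
    by apply: contraTneq ltx => px; rewrite -pb0 -px permKV ltxx.
  rewrite andbT; congr negb; apply/idP/imsetP=> [ltp|[b]].
    exists ((p^-1)%g x); rewrite ?inE //.
    by have := rhoP ((p^-1)%g x); rewrite ltp permKV => /eqP.
  rewrite inE => ltb ->; have := rhoP b; rewrite ltb => /eqP <-.
  by rewrite permK.
rewrite -big_distrr /=; congr (_ * _).
rewrite IHm //.
- by apply: eq_bigl => b; rewrite posS.
- move=> b; rewrite posS' => /orP[ltb|/eqP->]; last by rewrite /rho' eqxx.
  by rewrite rho'_old ?rho_cand.
move=> x y; rewrite !inE !posS' => /orP[ltx|/eqP->] /orP[lty|/eqP->] //.
- by rewrite !rho'_old // => /rho_inj->.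
- rewrite rho'_old // {1}/rho' eqxx => rx.
  by case/imsetP: unused_a; exists x; rewrite ?inE.
rewrite (rho'_old y) // {1}/rho' eqxx => ry.
by case/imsetP: unused_a; exists y; rewrite ?inE.
Qed.

Lemma sum_perm_ranks :
  \sum_(p : {perm T} | [forall b, p b \in cand b]) \prod_b f b (rank p b) =
  \prod_b \sum_(r < room b) f b r.
Proof.
by have := @sum_perm_extending 0 id; apply.
Qed.

End BoardSum.

(** * Nestings and crossings *)

(* The order of 'I_N, or its reverse: the values above the diagonal are treated
   from right to left. *)
Definition dlt (c : bool) N : rel 'I_N :=
  fun a b => if c then (a < b)%N else (b < a)%N.

Lemma dltxx c N : irreflexive (@dlt c N).
Proof. by case: c => x; rewrite /dlt ltnn. Qed.

Lemma dlt_trans c N : transitive (@dlt c N).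
Proof. by case: c => x y z; rewrite /dlt; lia. Qed.

Lemma dlt_total c N (x y : 'I_N) : x != y -> dlt c x y || dlt c y x.
Proof. by rewrite -val_eqE /dlt /=; case: c; lia. Qed.

Lemma dlt_neg c N (x y : 'I_N) : dlt (~~ c) x y = dlt c y x.
Proof. by case: c. Qed.

Section NestCross.

Variable N : nat.
Implicit Types (p : 'S_N) (a b : 'I_N).

Definition dnest c p b := #|[set a | dlt c a (p b) && dlt c b ((p^-1)%g a)]|.
Definition dcross c p b :=
  #|[set a | [&& dlt c (p b) a, dlt c a b & dlt c b ((p^-1)%g a)]]|.
Definition dcut c p b := #|[set a | dlt c a b && ~~ dlt c ((p^-1)%g a) b]|.

(** An arc starting before [b] and going back also ends before [b]; removing these from all such
    arcs ending before [b] leaves those over the cut. The two counts depend only on the sides of the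
    arcs. *)
Lemma dcutE c p b : dcut c p b =
  (#|[set a | dlt c a b && dlt c a ((p^-1)%g a)]| -
   #|[set a | dlt c a b && dlt c (p a) a]|)%N.
Proof.
rewrite -[X in (X - _)%N](cardsID [set a | dlt c ((p^-1)%g a) b]).
rewrite [X in (X + _)%N](_ : _ = #|[set a | dlt c a b && dlt c (p a) a]|).
  rewrite addKn; apply: eq_card => a; rewrite !inE.
  apply/andP/and3P=> [[ab npb]|[npb ab _]]; last by split.
  split=> //; case: (eqVneq a ((p^-1)%g a)) => [ea|].
    by rewrite -ea ab in npb.
  case/(dlt_total c)/orP=> // lt_pa.
  by rewrite (dlt_trans lt_pa ab) in npb.
rewrite -[RHS](card_imset _ (@perm_inj _ p)); apply: eq_card => a.
rewrite !inE; apply/andP/imsetP=> [[/andP[ab apa] pab]|[x]].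
  by exists ((p^-1)%g a); rewrite ?inE permKV // pab.
rewrite inE => /andP[xb pxx] ->; rewrite permK pxx xb.
by rewrite (dlt_trans pxx xb).
Qed.

(** An arc over the cut is that of [b] itself, or ends before [p b] and is nested, or ends between
    [p b] and [b] and crosses. *)
Lemma dnest_dcross c p b : dlt c (p b) b ->
  dcut c p b = (dnest c p b + dcross c p b).+1.
Proof.
move=> pbb; rewrite /dcut (cardsD1 (p b)) inE permK pbb dltxx add1n; congr _.+1.
rewrite -(cardsID [set a | dlt c a (p b)]); congr (_ + _)%N.
  apply: eq_card => a; rewrite !inE.
  apply/idP/idP=> [/andP[/and3P[nea ab npb] apb]|/andP[apb bpa]].
    rewrite apb; case: (eqVneq b ((p^-1)%g a)) => [eb|].
      by rewrite eb permKV eqxx in nea.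
    by case/(dlt_total c)/orP=> // lt_pa; rewrite lt_pa in npb.
  rewrite apb (dlt_trans apb pbb) /= andbT; apply/andP; split.
    by apply: contraTneq apb => ->; rewrite dltxx.
  by apply: contraTN bpa => pab; apply/negP=> /(dlt_trans pab); rewrite dltxx.
apply: eq_card => a; rewrite !inE.
apply/idP/idP=> [/andP[napb /and3P[nea ab npb]]|/and3P[pba ab bpa]].
  have /orP[apb|pba] := dlt_total c nea; first by rewrite apb in napb.
  rewrite pba ab; case: (eqVneq b ((p^-1)%g a)) => [eb|].
    by rewrite eb permKV eqxx in nea.
  by case/(dlt_total c)/orP=> // lt_pa; rewrite lt_pa in npb.
rewrite ab; apply/and4P; split=> //.
- by apply: contraTN pba => pab; apply/negP=> /(dlt_trans pab); rewrite dltxx.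
- by apply: contraTneq pba => ->; rewrite dltxx.
by apply: contraTN bpa => pab; apply/negP=> /(dlt_trans pab); rewrite dltxx.
Qed.

(* [Some true] below the diagonal, [Some false] above it. *)
Definition side p b : option bool :=
  if (p b < b)%N then Some true else if (b < p b)%N then Some false else None.

Lemma sideP c p b : reflect (side p b = Some c) (dlt c (p b) b).
Proof.
apply: (iffP idP); rewrite /side /dlt; case: c; case: ltngtP => //.
Qed.

Lemma sideN p b : (side p b == None) = (p b == b).
Proof. by rewrite /side -val_eqE; case: ltngtP. Qed.

Section Board.

Variables (R : comNzRingType) (cls tgt : 'I_N -> option bool).
Variable f : 'I_N -> nat -> R.
Hypothesis clsN : forall b, (cls b == None) = (tgt b == None).

(** [cls b] prescribes the side of the arc leaving [b], [tgt a] that of the arc arriving at [a]. *)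
Definition board b : {set 'I_N} :=
  if cls b is Some c then [set a | (tgt a == Some c) && dlt c a b] else [set b].

Definition board_rank p b := if cls b is Some c then dnest c p b else 0%N.

Definition board_room b :=
  if cls b is Some c then
    (#|[set a | (tgt a == Some c) && dlt c a b]| -
     #|[set a | (cls a == Some c) && dlt c a b]|)%N
  else 1%N.

Lemma boardP p :
  reflect (forall b, cls b = side p b /\ tgt b = omap negb (side (p^-1)%g b))
          [forall b, p b \in board b].
Proof.
apply: (iffP forallP) => [pP b|clsP b].
  have pbP := pP b; have := pP ((p^-1)%g b); rewrite permKV.
  have [clsb|[c clsb]] : cls b = None \/ exists c, cls b = Some c.
  - by case: (cls b) => [c|]; [right; exists c | left].
  - have tgtb : tgt b = None by apply/eqP; rewrite -clsN clsb.
    move: pbP; rewrite /board clsb inE => /eqP pb _.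
    rewrite tgtb; split; apply/esym/eqP; first by rewrite sideN pb.
    by have := sideN (p^-1)%g b; rewrite -{2}pb permK eqxx => /eqP->.
  move=> pb'; split.
    by move: pbP; rewrite /board clsb !inE => /andP[_ /sideP->].
  move: pb'; rewrite /board; case cls': (cls _) => [c'|].
    rewrite inE => /andP[/eqP-> lt_b].
    suff /sideP-> : dlt (~~ c') ((p^-1)%g b) b by rewrite /= negbK.
    by rewrite dlt_neg.
  by rewrite inE => /eqP eb; rewrite -eb clsb in cls'.
have [clsb _] := clsP b; have [_] := clsP (p b).
rewrite /board clsb; case side_b: (side p b) => [c|]; last first.
  by move/eqP: side_b; rewrite sideN inE.
move/sideP: (side_b) => lt_b tgtb; rewrite inE lt_b andbT tgtb.
have /sideP-> : dlt (~~ c) ((p^-1)%g (p b)) (p b) by rewrite dlt_neg permK.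
by rewrite /= negbK.
Qed.

Lemma board_sum :
  \sum_(p : 'S_N | [forall b, p b \in board b]) \prod_b f b (board_rank p b) =
  \prod_b \sum_(r < board_room b) f b r.
Proof.
(* Three disjoint ranges: arcs below the diagonal from left to right, then fixed points, then arcs
   above the diagonal from right to left. *)
pose pos (b : 'I_N) : nat :=
  if cls b is Some c then if c then b : nat else (3 * N - b)%N else (N + b)%N.
pose low b' b := if cls b is Some c then cls b' == Some c else false.
pose ltb b := if cls b is Some c then @dlt c N else @dlt true N.
have posi : injective pos.
  move=> x y; rewrite /pos => eq_pos; apply: val_inj; move: eq_pos => /=.
  have := ltn_ord x; have := ltn_ord y.
  by case: (cls x) => [[]|]; case: (cls y) => [[]|]; lia.
have posP c b' b : cls b = Some c ->
    (pos b' < pos b)%N && (cls b' == Some c) = (cls b' == Some c) && dlt c b' b.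
  rewrite /pos => ->; case: eqP => [->|]; rewrite ?andbF //= andbT.
  by have := ltn_ord b; have := ltn_ord b'; rewrite /dlt; case: c; lia.
(* Boards of one side grow with the position; all other pairs of distinct boards are disjoint. *)
have boardlow b' b a : (pos b' < pos b)%N -> a \in board b' ->
    (a \in board b) = low b' b.
  rewrite /low /board; case clsb: (cls b) => [c|]; last first.
    rewrite inE => lt_pos; case clsb': (cls b') => [c'|]; rewrite inE.
      case/andP=> /eqP tgta _; apply: contra_eqF tgta => /eqP->.
      by have := clsN b; rewrite clsb eqxx => /esym/eqP->.
    by move/eqP->; apply: contraTF lt_pos => /eqP->; rewrite ltnn.
  move=> lt_pos; rewrite inE; case clsb': (cls b') => [c'|]; rewrite inE.
    case/andP=> /eqP-> lta; rewrite andb_idr //; move=> /eqP[eqc].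
    have:= posP c b' b clsb; rewrite lt_pos clsb' eqc eqxx /= => /esym ltb'b.
    by apply: dlt_trans ltb'b; rewrite -eqc.
  move/eqP->; have := clsN b'; rewrite clsb' eqxx => /esym/eqP->.
  by [].
transitivity (\prod_b \sum_(r < room pos board low b) f b r).
  rewrite -(@sum_perm_ranks _ _ pos board low ltb) //.
  - apply: eq_bigr => p /boardP pP; apply: eq_bigr => b _; congr f.
    rewrite /rank /board_rank /ltb; case clsb: (cls b) => [c|].
      apply: eq_card => a; rewrite !inE /board clsb inE.
      have [cb _] := pP b; rewrite cb in clsb; move/sideP: (clsb) => lt_b.
      have [_ tgta] := pP a.
      (* A nested value lies on the board of [b], and its source comes after [b] on the same side,
         so it is still free at [b]. *)
      apply/idP/idP=> [/andP[apb bpa]|]; last first.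
        case/and3P=> /andP[tgtc ab] apb lt_pos; rewrite apb /=.
        have ca : cls ((p^-1)%g a) = Some c.
          have [-> _] := pP ((p^-1)%g a); apply/sideP; rewrite permKV.
          rewrite -dlt_neg; apply/sideP; move: tgtc; rewrite tgta.
          by case: side => //= c0 /eqP[<-]; rewrite negbK.
        have cb' : cls b = Some c by rewrite cb.
        case: (eqVneq b ((p^-1)%g a)) => [eb|].
          by move: apb; rewrite {1}eb permKV dltxx.
        case/(dlt_total c)/orP=> // lt_pa.
        have := posP c ((p^-1)%g a) b cb'; rewrite ca eqxx lt_pa andbT /=.
        by rewrite ltnNge (ltnW lt_pos).
      have ab := dlt_trans apb lt_b; have apa := dlt_trans ab bpa.
      have sa : side (p^-1)%g a = Some (~~ c) by apply/sideP; rewrite dlt_neg.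
      have ca : cls ((p^-1)%g a) = Some c.
        by have [-> _] := pP ((p^-1)%g a); apply/sideP; rewrite permKV.
      have := posP c b _ ca; rewrite cb clsb eqxx bpa andbT /= => ->.
      by rewrite tgta sa /= negbK eqxx ab apb.
    apply/esym/eqP; rewrite cards_eq0; apply/eqP/setP=> a; rewrite !inE.
    rewrite /board clsb inE; have [cb _] := pP b.
    move/eqP: clsb; rewrite cb sideN => /eqP->.
    by case: eqP => // ->; rewrite dltxx.
  - by move=> b; rewrite /ltb; case: (cls b) => [c|]; apply: dltxx.
  - by move=> b; rewrite /ltb; case: (cls b) => [c|]; apply: dlt_trans.
  by move=> b x y; rewrite /ltb; case: (cls b) => [c|]; apply: dlt_total.
apply: eq_bigr => b _; rewrite (_ : room pos board low b = board_room b) //.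
rewrite /room /board_room /board /low; case clsb: (cls b) => [c|].
  by congr (_ - _)%N; apply: eq_card => b'; rewrite !inE posP.
rewrite cards1 (_ : [set _ | _] = set0) ?cards0 //.
by apply/setP=> x; rewrite !inE andbF.
Qed.

End Board.

End NestCross.

(** * Continued fractions and paths *)

Section PowerSeries.

Variable R : comNzRingType.
Implicit Types (f g h : nat -> R) (c : R).

Lemma fps_mul_poly f g n m : (n < m)%N ->
  fps_mul f g n = ((\poly_(i < m) f i) * (\poly_(i < m) g i))`_n.
Proof.
move=> ltnm; rewrite coefM; apply: eq_bigr => i _.
by rewrite !coef_poly !ifT //; have := ltn_ord i; lia.
Qed.

Lemma eq_fps_mul f f' g g' n :
    (forall i, (i <= n)%N -> f i = f' i) ->
    (forall i, (i <= n)%N -> g i = g' i) ->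
  fps_mul f g n = fps_mul f' g' n.
Proof.
move=> eqf eqg; apply: eq_bigr => i _.
by rewrite eqf ?eqg ?leq_subr // -ltnS.
Qed.

(** Coefficient [n] involves only terms up to [n], so associativity is inherited from truncated
    polynomials. *)
Lemma fps_mulA f g h n :
  fps_mul f (fps_mul g h) n = fps_mul (fps_mul f g) h n.
Proof.
have polyE f1 g1 i : (i <= n)%N ->
    fps_mul f1 g1 i = ((\poly_(i < n.+1) f1 i) * (\poly_(i < n.+1) g1 i))`_i.
  by move=> lein; apply: fps_mul_poly.
pose p f1 := \poly_(i < n.+1) f1 i : {poly R}.
have coefp f1 i : (i <= n)%N -> (p f1)`_i = f1 i.
  by move=> lein; rewrite coef_poly ltnS lein.
transitivity ((p f * (p g * p h))`_n).
  rewrite coefM; apply: eq_fps_mul => i lein; first by rewrite coefp.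
  by rewrite polyE.
rewrite mulrA coefM; apply: eq_fps_mul => i lein; last by rewrite coefp.
by rewrite polyE.
Qed.

Lemma fps_mul_const c f n : fps_mul (fps_const c) f n = c * f n.
Proof.
rewrite /fps_mul big_ord_recl /= subn0 big1 ?addr0 // => i _.
by rewrite mul0r.
Qed.

Lemma fps_mulZ c f g n :
  fps_mul (fun i => c * f i) g n = c * fps_mul f g n.
Proof.
by rewrite /fps_mul big_distrr /=; apply: eq_bigr => i _; rewrite mulrA.
Qed.

Lemma fps_mul_monomial c g n :
  fps_mul (fps_mul (fps_const c) (fps_t R)) g n =
  if n is m.+1 then c * g m else 0.
Proof.
rewrite /fps_mul; under eq_bigr => i _ do
  rewrite -/(fps_mul (fps_const c) (fps_t R) i) fps_mul_const /fps_t.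
case: n => [|n]; first by rewrite big_ord1 /= mulr0 mul0r.
rewrite !big_ord_recl /= mulr0 mul0r add0r mulr1 /bump /= subSS subn0.
by rewrite big1 ?addr0 // => i _; rewrite mul0r.
Qed.

Variables (alpha delta : nat -> R).

(** Writing [U] and [G] for the two fractions, U (1 - delta_j t - alpha_j t G) = 1 is solved for the
    coefficient of t^n in U. *)
Lemma tfrac_trunc_rec K j n :
  tfrac_trunc alpha delta K.+1 j n =
  if n is m.+1 then
    delta j * tfrac_trunc alpha delta K.+1 j m +
    alpha j * fps_mul (tfrac_trunc alpha delta K.+1 j)
                (tfrac_trunc alpha delta K j.+1) m
  else 1.
Proof.
set U := tfrac_trunc _ _ K.+1 j; set G := tfrac_trunc _ _ K j.+1.
pose D := fps_sub
  (fps_sub (fps_const 1) (fps_mul (fps_const (delta j)) (fps_t R)))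
  (fps_mul (fps_mul (fps_const (alpha j)) (fps_t R)) G).
have DE i : D i = if i is k.+1 then - (delta j * (k == 0%N)%:R) - alpha j * G k
                  else 1.
  rewrite /D /fps_sub /fps_add /fps_opp fps_mul_const fps_mul_monomial /fps_t.
  by case: i => [|k] /=; rewrite ?mulr0 ?subr0 ?sub0r // eqSS.
have UD : fps_mul U D =1 fps_const 1 by apply: (@fps_invP R D); rewrite DE.
clearbody D U; case: n => [|n].
  by have := UD 0%N; rewrite /fps_mul big_ord1 DE mulr1.
have := UD n.+1; rewrite /fps_mul big_ord_recr /= subnn DE mulr1.
move/eqP; rewrite addrC addr_eq0 => /eqP ->.
rewrite -sumrN big_distrr /= big_ord_recr /=.
rewrite [delta j * U n + _]addrC big_ord_recr /=.
under eq_bigr => i _.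
  have -> : (n.+1 - i = (n - i.+1).+2)%N by have := ltn_ord i; lia.
  rewrite DE /= mulr0 oppr0 sub0r.
  have -> : ((n - i.+1).+1 = n - i)%N by have := ltn_ord i; lia.
  rewrite mulrN opprK mulrCA.
over.
rewrite -addrA; congr (_ + _).
rewrite subSnn DE subnn /=; ring.
Qed.

End PowerSeries.

(** * Lattice paths and the truncated fraction *)

Section PathSums.

Variables (R : comNzRingType) (alpha delta rise fall : nat -> R).
Hypothesis alphaE : forall H, alpha H.+1 = rise H * fall H.+1.
Hypothesis delta0 : forall H, delta H.+2 = 0.

(** Paths from height [H] back to [H] within the heights from [H] to [K - 1]; t counts the rises and
    the long level steps at height 0. *)
Let level K H := tfrac_trunc alpha delta (K - H) H.+1.

(* The series of the paths from height [H] down to [0], decomposed at the first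
   visits of the lower heights, in the fraction truncated at height [K]. *)
Fixpoint descents K H : nat -> R :=
  if H is H'.+1 then
    fun n => fall H * fps_mul (descents K H') (level K H) n
  else level K 0.

Lemma levelE K H n : (H < K)%N ->
  level K H n = if n is m.+1 then
    delta H.+1 * level K H m +
    alpha H.+1 * fps_mul (level K H) (level K H.+1) m else 1.
Proof.
move=> ltHK; rewrite /level.
have -> : (K - H = (K - H.+1).+1)%N by lia.
exact: tfrac_trunc_rec.
Qed.

Lemma descents0 K n : (0 < K)%N ->
  descents K 0 n = if n is m.+1 then
    delta 1 * descents K 0 m + rise 0 * descents K 1 m else 1.
Proof.
move=> K0; rewrite /= levelE //; case: n => // n.
by rewrite alphaE mulrA.
Qed.

(** Decomposition by the first step: in the recurrence of [level K H.+1], the constant term gives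
    the fall, and [alpha H.+2] supplies a first rise and the later fall contained in
    [descents K H.+2]. *)
Lemma descentsS K H n : (H.+1 < K)%N ->
  descents K H.+1 n = fall H.+1 * descents K H n +
    (if n is m.+1 then rise H.+1 * descents K H.+2 m else 0).
Proof.
move=> ltHK; rewrite /=; case: n => [|n].
  by rewrite /fps_mul big_ord1 levelE // mulr1 addr0.
rewrite {1}/fps_mul big_ord_recr /= subnn levelE // mulr1.
rewrite mulrDr addrC; congr (_ + _).
have -> : \sum_(i < n.+1) descents K H i * level K H.+1 (n.+1 - i) =
    fps_mul (descents K H)
      (fun i => alpha H.+2 * fps_mul (level K H.+1) (level K H.+2) i) n.
  apply: eq_bigr => i _.
  have -> : (n.+1 - i = (n - i).+1)%N by have := ltn_ord i; lia.
  by rewrite levelE // delta0 mul0r add0r.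
have -> : fps_mul (descents K H)
    (fun i => alpha H.+2 * fps_mul (level K H.+1) (level K H.+2) i) n =
  alpha H.+2 * fps_mul (descents K H) (fps_mul (level K H.+1) (level K H.+2)) n.
  by rewrite /fps_mul big_distrr /=; apply: eq_bigr => i _; rewrite mulrCA.
rewrite fps_mulA alphaE fps_mulZ; ring.
Qed.

(* [up h n] and [dn h n] sum the weights of the paths that end at height [0]
   after [2n], resp. [2n+1], more steps and start at height [2h], resp. [2h-1];
   [dn 0] is the middle of a long level step at height [0]. *)
Variables (up dn : nat -> nat -> R) (levo leve : R).
Hypothesis delta1 : delta 1 = leve * levo.
Hypothesis up0 : forall h, up h 0 = (h == 0%N)%:R.
Hypothesis upS : forall h n, up h n.+1 = rise h.*2 * dn h.+1 n +
  (if h is 0 then levo else fall h.*2) * dn h n.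
Hypothesis dn0 : forall n, dn 0 n = leve * up 0 n.
Hypothesis dnS : forall h n,
  dn h.+1 n = fall h.*2.+1 * up h n + rise h.*2.+1 * up h.+1 n.

(** A path of [2n] steps from height [2h] to 0 has [n - h] rises, a long level step standing for a
    rise and a fall. *)
Lemma up_descents K h n : (n.*2 < K)%N ->
  up h n = if (h <= n)%N then descents K h.*2 (n - h)%N else 0.
Proof.
elim: n h => [|n IHn] h ltnK.
  by rewrite up0 leqn0; case: h => //; rewrite descents0.
have dn_descents k : dn k.+1 n =
    if (k <= n)%N then descents K k.*2.+1 (n - k)%N else 0.
  rewrite dnS !IHn; try lia; case: (leqP k n) => lekn; last first.
    by rewrite ifF ?mulr0 ?addr0 //; lia.
  rewrite descentsS; last by lia.
  congr (_ + _); case: (ltnP k n) => ltkn; last first.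
    have -> : (n - k = 0)%N by lia.
    by rewrite mulr0.
  have -> : (n - k = (n - k.+1).+1)%N by lia.
  by [].
rewrite upS; case: h => [|h].
  rewrite dn0 dn_descents IHn; last by lia.
  have K0 : (0 < K)%N by lia.
  rewrite !leq0n !subn0 -[0.*2]/0%N [RHS](descents0 _ K0).
  by rewrite delta1 addrC mulrA [levo * leve]mulrC.
rewrite !dn_descents addrC ltnS; case: (leqP h n) => lehn; last first.
  by rewrite ifF ?mulr0 ?addr0 //; lia.
have hK : (h.*2.+2 < K)%N by lia.
rewrite [RHS](descentsS _ hK).
rewrite subSS; congr (_ + _); case: (ltnP h n) => lthn; last first.
  have -> : (n - h = 0)%N by lia.
  by rewrite mulr0.
have -> : (n - h = (n - h.+1).+1)%N by lia.
by [].
Qed.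

Lemma is_tfrac_paths : is_tfrac alpha delta (up 0).
Proof.
move=> n; exists n.*2.+1 => K ltnK.
by rewrite (@up_descents K) // subn0 /= /level subn0.
Qed.

End PathSums.

(** * Words of cycle types *)

(* At an index of given parity, a D-permutation has only three possible cycle
   types, encoded by a letter: [None] for a fixed point, [Some true] for a cycle
   valley (odd index) or a cycle peak (even index), [Some false] for a cycle
   double rise (odd) or a cycle double fall (even). *)
Local Notation letter := (option bool).

Definition side_letter (o : bool) (l : letter) : letter :=
  if l is Some _ then Some (~~ o) else None.

Definition inv_side_letter (o : bool) (l : letter) : letter :=
  if l is Some turn then Some (if turn then ~~ o else o) else None.

Definition letter_of N (s : 'S_N) (b : 'I_N) : letter :=
  if s b == b then None else Some (cval s b || cpeak s b).

Definition word_of N (s : 'S_N) : N.-tuple letter :=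
  [tuple letter_of s b | b < N].

Lemma perm_inv_fix N (s : 'S_N) b : ((s^-1)%g b == b) = (s b == b).
Proof. by rewrite -(inj_eq (@perm_inj _ s)) permKV eq_sym. Qed.

(** At each parity the three letters exhaust the pairs of sides that a D-permutation allows, since
    [s] and its inverse have the same fixed points. *)
Lemma word_ofP N (s : 'S_N) (t : N.-tuple letter) :
  reflect (forall b, side s b = side_letter (oddidx b) (tnth t b) /\
                     side (s^-1)%g b = inv_side_letter (oddidx b) (tnth t b))
          (Dperm s && (word_of s == t)).
Proof.
have letterP b l : ((oddidx b ==> (b <= s b)%N) && (evenidx b ==> (s b <= b)%N))
    && (letter_of s b == l) = (side s b == side_letter (oddidx b) l) &&
                     (side (s^-1)%g b == inv_side_letter (oddidx b) l).
  rewrite /letter_of /side /cval /cpeak /evenidx /oddidx.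
  have := perm_inv_fix s b; rewrite -!val_eqE /=.
  by case: (ltngtP (s b) b); case: (ltngtP ((s^-1)%g b) b) => //=;
     case: (odd b) => //=; case: l => [[]|].
apply: (iffP andP) => [[/forallP Ds /eqP <-] b|sP].
  have := letterP b (letter_of s b); rewrite Ds eqxx /=.
  by rewrite tnth_mktuple => /esym/andP[/eqP-> /eqP->].
have {}sP b : ((oddidx b ==> (b <= s b)%N) && (evenidx b ==> (s b <= b)%N))
    && (letter_of s b == tnth t b).
  by rewrite letterP; have [-> ->] := sP b; rewrite !eqxx.
split; first by apply/forallP=> b; have /andP[] := sP b.
apply/eqP/eq_from_tnth => b; rewrite tnth_mktuple.
by have /andP[_ /eqP] := sP b.
Qed.

Lemma card_set_sum (T : finType) (P : pred T) :
  #|[set a | P a]| = (\sum_a (P a : nat))%N.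
Proof.
rewrite -sum1_card big_mkcond; apply: eq_bigr => a _.
by rewrite inE; case: (P a).
Qed.

Section Heights.

Variables (N : nat) (t : N.-tuple letter).

Definition turns o (S : pred 'I_N) :=
  #|[set a | (tnth t a == Some true) && (oddidx a == o) && S a]|.

(* The number of arcs above (or below) the diagonal among which that of [b] is
   chosen; a cycle valley counts the arc that it opens. *)
Definition arcs_at (b : 'I_N) :=
  (((tnth t b == Some true) && oddidx b) + turns true (fun a => (a < b)%N) -
   turns false (fun a => (a < b)%N))%N.

Definition balanced := turns true predT == turns false predT.

Lemma turns_split o (b : 'I_N) : turns o predT =
  (turns o (fun a => (a < b)%N) +
   ((tnth t b == Some true) && (oddidx b == o)) +
   turns o (fun a => (b < a)%N))%N.
Proof.
have turnsE S : turns o S =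
    (\sum_(a | S a) ((tnth t a == Some true) && (oddidx a == o) : nat))%N.
  rewrite /turns card_set_sum [RHS]big_mkcond.
  by apply: eq_bigr => a _; case: (S a); rewrite ?andbF // andbT.
rewrite !turnsE (bigID [pred a : 'I_N | (a < b)%N]) /= -addnA; congr (_ + _)%N.
rewrite (bigD1 b) ?ltnn //=; congr (_ + _)%N.
by apply: eq_bigl => a; rewrite -val_eqE /=; case: ltngtP.
Qed.

End Heights.

Definition choices (l : letter) (k : nat) : nat := if l is Some _ then k else 1.

Section Boards.

Variables (N : nat) (t : N.-tuple letter) (e : bool).

(* [e = false] describes the boards of the permutation s itself, [e = true]
   those of its inverse. *)
Definition cls (b : 'I_N) : option bool :=
  (if e then inv_side_letter else side_letter) (oddidx b) (tnth t b).

Definition tgt (b : 'I_N) : option bool :=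
  omap negb ((if e then side_letter else inv_side_letter) (oddidx b) (tnth t b)).

Lemma cls_tgtN b : (cls b == None) = (tgt b == None).
Proof. by rewrite /cls /tgt; case: e; case: (tnth t b) => [[]|]. Qed.

(** At a double rise or double fall the arriving and leaving arcs lie on the same side, so [passes]
    cancels and only valleys and peaks remain. *)
Lemma card_classes c (S : pred 'I_N) :
  (#|[set a | (tgt a == Some c) && S a]| -
   #|[set a | (cls a == Some c) && S a]| = turns t c S - turns t (~~ c) S)%N.
Proof.
pose passes := #|[set a | (tnth t a == Some false) &&
                          (oddidx a == (e == c)) && S a]|.
have -> : #|[set a | (tgt a == Some c) && S a]| = (turns t c S + passes)%N.
  rewrite /turns /passes !card_set_sum -big_split /=; apply: eq_bigr => a _.
  rewrite /tgt {passes}; case: (S a); rewrite ?andbF // !andbT.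
  by case: e c (oddidx a) (tnth t a) => [] [] [] [[]|].
have -> : #|[set a | (cls a == Some c) && S a]| = (turns t (~~ c) S + passes)%N.
  rewrite /turns /passes !card_set_sum -big_split /=; apply: eq_bigr => a _.
  rewrite /cls {passes}; case: (S a); rewrite ?andbF // !andbT.
  by case: e c (oddidx a) (tnth t a) => [] [] [] [[]|].
by rewrite subnDr.
Qed.

(** Above the diagonal the room counts peaks minus valleys to the right of [b]; balance converts it
    into valleys minus peaks on the left, plus the valley at [b] if any. *)
Lemma board_roomE b : balanced t ->
  board_room cls tgt b = choices (tnth t b) (arcs_at t b).
Proof.
move=> /eqP bal; rewrite /board_room.
case clsb: (cls b) => [c|]; last first.
  by move: clsb; rewrite /cls; case: e; case: (tnth t b).
rewrite (card_classes c (fun a => dlt c a b)) /arcs_at.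
have := turns_split t true b; have := turns_split t false b; rewrite -bal.
move: clsb; rewrite /cls /choices; case: (oddidx b) (tnth t b) => [] [[]|];
  case: e => //= -[<-] /=; rewrite /dlt /=; try by []; lia.
Qed.

Lemma perm_boardP (s : 'S_N) :
  [forall b, (if e then s^-1 else s)%g b \in board cls tgt b] =
  Dperm s && (word_of s == t).
Proof.
apply/(boardP cls_tgtN)/word_ofP => sP b; have := sP b; rewrite /cls /tgt.
  by case: e => -[]; rewrite ?invgK;
    case: (tnth t b) => [[]|]; case: (oddidx b);
    case: (side _ _) => [[]|]; case: (side _ _) => [[]|].
by case: e => -[sE siE]; rewrite ?invgK sE siE.
Qed.

End Boards.

(** Arcs above the diagonal start at valleys and double rises, and end at peaks and double rises. *)
Lemma word_of_balanced N (s : 'S_N) : Dperm s -> balanced (word_of s).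
Proof.
move=> Ds; have /word_ofP sP : Dperm s && (word_of s == word_of s).
  by rewrite Ds eqxx.
pose t := word_of s.
pose rises := #|[set a : 'I_N | (tnth t a == Some false) && oddidx a]|.
have excE : #|[set a | side s a == Some false]| = (turns t true predT + rises)%N.
  rewrite /turns /rises !card_set_sum -big_split /=; apply: eq_bigr => a _.
  have [-> _] := sP a; rewrite -/t.
  by case: (oddidx a) (tnth t a) => [] [[]|].
have invE : #|[set a | side (s^-1)%g a == Some true]| =
    (turns t false predT + rises)%N.
  rewrite /turns /rises !card_set_sum -big_split /=; apply: eq_bigr => a _.
  have [_ ->] := sP a; rewrite -/t.
  by case: (oddidx a) (tnth t a) => [] [[]|].
rewrite /balanced -(eqn_add2r rises) -excE -invE.
rewrite -(card_imset _ (@perm_inj _ s)); apply/eqP/eq_card => a.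
rewrite inE; apply/imsetP/eqP=> [[x]|/sideP lt_a].
  rewrite inE => /eqP/sideP lt_x ->; apply/sideP.
  by rewrite permK -dlt_neg.
exists ((s^-1)%g a); last by rewrite permKV.
by rewrite inE; apply/eqP/sideP; rewrite permKV -dlt_neg.
Qed.

(** * From permutations to words and heights *)

Section WordSums.

Variables (R : comNzRingType) (loc : bool -> letter -> nat -> nat -> R).

Definition letter_sum o l k : R := \sum_(r < choices l k) loc o l k r.

Definition word_weight N (t : N.-tuple letter) : R :=
  \prod_(b < N) letter_sum (oddidx b) (tnth t b) (arcs_at t b).

Lemma sum_Dperm_words N (e : bool) (w : 'S_N -> R) :
    (forall s, Dperm s -> w s =
      \prod_b loc (oddidx b) (letter_of s b) (arcs_at (word_of s) b)
               (board_rank (cls (word_of s) e) (if e then s^-1 else s)%g b)) ->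
  \sum_(s : 'S_N | Dperm s) w s =
  \sum_(t : N.-tuple letter | balanced t) word_weight t.
Proof.
move=> wE; rewrite (partition_big (@word_of N) (@balanced N)); last first.
  exact: word_of_balanced.
apply: eq_bigr => t bal.
pose f (b : 'I_N) := loc (oddidx b) (tnth t b) (arcs_at t b).
transitivity (\sum_(s : 'S_N | Dperm s && (word_of s == t))
    \prod_b f b (board_rank (cls t e) (if e then s^-1 else s)%g b)).
  apply: eq_bigr => s /andP[Ds /eqP Dt]; rewrite wE // Dt.
  apply: eq_bigr => b _; rewrite /f.
  by have -> : tnth t b = letter_of s b by rewrite -Dt tnth_mktuple.
rewrite -(eq_bigl _ _ (@perm_boardP N t e)).
transitivity (\sum_(p : 'S_N | [forall b, p b \in board (cls t e) (tgt t e) b])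
    \prod_b f b (board_rank (cls t e) p b)).
  by case: (e) => //; rewrite [RHS](reindex_inj invg_inj).
rewrite (board_sum _ (cls_tgtN t e)); apply: eq_bigr => b _.
by rewrite board_roomE.
Qed.

(** [h] is the number of valleys minus peaks so far. A peak at [h = 0] has an empty [letter_sum],
    which makes the truncated [h.-1] harmless. *)
Fixpoint heights_sum (o : bool) (h n : nat) : R :=
  if n is n'.+1 then
    letter_sum o (Some true) (if o then h.+1 else h) *
      heights_sum (~~ o) (if o then h.+1 else h.-1) n' +
    (letter_sum o (Some false) h + letter_sum o None h) *
      heights_sum (~~ o) h n'
  else (h == 0%N)%:R.

Fixpoint turn_count (o : bool) (w : seq letter) : nat :=
  if w is l :: w' then (((l == Some true) && o) + turn_count (~~ o) w')%N else 0%N.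

(** Valleys [v] and peaks [p] are kept apart, as in [arcs_at]; the final test [v == p] expresses
    balance. *)
Fixpoint seq_weight (o : bool) (v p : nat) (w : seq letter) : R :=
  if w is l :: w' then
    letter_sum o l (((l == Some true) && o) + v - p)%N *
      seq_weight (~~ o) (v + ((l == Some true) && o))
                 (p + ((l == Some true) && ~~ o)) w'
  else (v == p)%:R.

Lemma turn_countE o w : turn_count o w =
  (\sum_(i < size w) ((nth None w i == Some true) && (o (+) odd i) : nat))%N.
Proof.
elim: w o => [|l w IHw] o; first by rewrite big_ord0.
rewrite /= big_ord_recl /= addbF IHw; congr (_ + _)%N.
by apply: eq_bigr => i _; rewrite /= addbN addNb.
Qed.

Lemma seq_weightE o v p w : seq_weight o v p w =
  (v + turn_count o w == p + turn_count (~~ o) w)%N%:R *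
  \prod_(i < size w) letter_sum (o (+) odd i) (nth None w i)
    (((nth None w i == Some true) && (o (+) odd i)) +
     (v + turn_count o (take i w)) - (p + turn_count (~~ o) (take i w)))%N.
Proof.
elim: w o v p => [|l w IHw] o v p; first by rewrite big_ord0 mulr1 /= !addn0.
rewrite [LHS]/= IHw big_ord_recl /= addbF !addn0 negbK mulrCA !addnA.
do 2![congr (_ * _)].
by apply: eq_bigr => i _; rewrite /= addbN addNb !addnA.
Qed.

Lemma sum_letters (F : letter -> R) :
  \sum_l F l = F (Some true) + (F (Some false) + F None).
Proof.
rewrite (bigD1 (Some true)) // (bigD1 (Some false)) // (bigD1 None) //=.
by rewrite big_pred0 ?addr0 //; case=> [[]|].
Qed.

Lemma sum_cons_tuple n (F : n.+1.-tuple letter -> R) :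
  \sum_t F t = \sum_l \sum_(t : n.-tuple letter) F [tuple of l :: t].
Proof.
rewrite pair_big /= (reindex (fun x : letter * n.-tuple letter =>
  [tuple of x.1 :: x.2])) //=.
exists (fun t => (thead t, [tuple of behead t])) => [[l t]|t] _ /=.
  by congr (_, _); apply: val_inj.
by rewrite -tuple_eta.
Qed.

Lemma sum_seq_weight o v p n : (p <= v)%N ->
  \sum_(t : n.-tuple letter) seq_weight o v p t = heights_sum o (v - p) n.
Proof.
elim: n o v p => [|n IHn] o v p lepv.
  rewrite (big_pred1 [tuple]) /=; last by move=> t; apply/esym/eqP; apply: tuple0.
  by rewrite subn_eq0 eqn_leq lepv andbT.
rewrite sum_cons_tuple sum_letters /= ?andbF ?addn0 ?add0n -!big_distrr /=.
rewrite (IHn _ v p) // mulrDl; congr (_ + _).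
case: o; rewrite /= ?addn0 ?addn1 ?add1n ?add0n.
  by rewrite IHn ?subSn // leqW.
move: lepv; rewrite leq_eqVlt => /predU1P[->|ltpv]; last first.
  by rewrite IHn // subnS.
by rewrite subnn /letter_sum !big_ord0 !mul0r.
Qed.

Lemma sum_balanced_words N :
  \sum_(t : N.-tuple letter | balanced t) word_weight t = heights_sum true 0 N.
Proof.
rewrite -(@sum_seq_weight true 0 0) // big_mkcond; apply: eq_bigr => t _.
have turnsE o (S : pred 'I_N) m : (m <= N)%N -> (forall a, S a = (a < m)%N) ->
    turns t o S = turn_count o (take m t).
  move=> lemN SE; rewrite turn_countE size_takel ?size_tuple //.
  rewrite (big_ord_widen N (fun i => nat_of_bool
     ((nth None (take m t) i == Some true) && (o (+) odd i)))) //.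
  rewrite /turns card_set_sum [RHS]big_mkcond /=.
  apply: eq_bigr => a _; rewrite SE; case: ltnP => ltam; last by rewrite andbF.
  rewrite nth_take // (tnth_nth None) andbT /oddidx /=.
  by case: (_ == Some true); case: (odd a); case: o.
have predTE (a : 'I_N) : predT a = (a < N)%N by rewrite ltn_ord.
rewrite seq_weightE !add0n /balanced !(turnsE _ _ N) //.
rewrite take_oversize ?size_tuple //; case: eqP; rewrite ?mul0r // mul1r => _.
rewrite /word_weight; apply: eq_bigr => b _.
rewrite !add0n /arcs_at !(turnsE _ _ b) //; try exact: ltnW.
by rewrite (tnth_nth None) /oddidx.
Qed.

End WordSums.

(** * The statistics in terms of nestings and crossings *)

Section Records.

Variable N : nat.
Implicit Types (s p : 'S_N) (b : 'I_N).

Lemma antirecord_dnest s b : antirecord s b = (dnest true s b == 0%N).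
Proof.
rewrite cards_eq0; apply/forallP/eqP => [arec|/setP nest0 j].
  apply/setP=> a; rewrite !inE /dlt; apply: contraTF (arec ((s^-1)%g a)).
  by rewrite permKV => /andP[lt1 ->]; rewrite -leqNgt ltnW.
apply/implyP=> ltbj; have := nest0 (s j); rewrite !inE /dlt permK ltbj andbT.
move/negbT; rewrite -leqNgt leq_eqVlt => /predU1P[/val_inj/perm_inj eqbj|//].
by rewrite eqbj ltnn in ltbj.
Qed.

Lemma record_dnest s b : record s b = (dnest false s b == 0%N).
Proof.
rewrite cards_eq0; apply/forallP/eqP => [arec|/setP nest0 j].
  apply/setP=> a; rewrite !inE /dlt; apply: contraTF (arec ((s^-1)%g a)).
  by rewrite permKV => /andP[lt1 ->]; rewrite -leqNgt ltnW.
apply/implyP=> ltbj; have := nest0 (s j); rewrite !inE /dlt permK ltbj andbT.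
move/negbT; rewrite -leqNgt leq_eqVlt => /predU1P[/val_inj/perm_inj eqbj|//].
by rewrite eqbj ltnn in ltbj.
Qed.

(** Transposing the diagram of a permutation exchanges records and antirecords. *)
Lemma record_inv s b : record s ((s^-1)%g b) = antirecord (s^-1)%g b.
Proof.
rewrite antirecord_dnest cards_eq0; apply/forallP/eqP => [rec|/setP nest0 j].
  apply/setP=> a; rewrite !inE /dlt invgK; apply: contraTF (rec a).
  by rewrite permKV => /andP[-> lt1]; rewrite /= -leqNgt ltnW.
apply/implyP=> ltj; have := nest0 j; rewrite !inE /dlt invgK ltj permKV /=.
move/negbT; rewrite -leqNgt leq_eqVlt => /predU1P[/val_inj eqj|//].
by rewrite -eqj permK ltnn in ltj.
Qed.

Lemma antirecord_inv s b : antirecord s ((s^-1)%g b) = record (s^-1)%g b.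
Proof.
rewrite record_dnest cards_eq0; apply/forallP/eqP => [rec|/setP nest0 j].
  apply/setP=> a; rewrite !inE /dlt invgK; apply: contraTF (rec a).
  by rewrite permKV => /andP[-> lt1]; rewrite /= -leqNgt ltnW.
apply/implyP=> ltj; have := nest0 j; rewrite !inE /dlt invgK ltj permKV /=.
move/negbT; rewrite -leqNgt leq_eqVlt => /predU1P[/val_inj eqj|//].
by rewrite eqj permK ltnn in ltj.
Qed.

(** Pigeonhole: there are more values before [p b] than indices before [b]. Hence no index with
    [b < p b] is an antirecord, and none with [p b < b] is a record. *)
Lemma dnest_neq0 c p b : dlt c b (p b) -> dnest c p b != 0%N.
Proof.
move=> lt_b; apply/negP; rewrite cards_eq0 => /eqP/setP nest0.
pose below (x : 'I_N) := [set a | dlt c a x].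
have : (#|below b| < #|below (p b)|)%N.
  apply/proper_card/properP; split.
    by apply/subsetP=> a; rewrite !inE => /dlt_trans->.
  by exists b; rewrite !inE // dltxx.
rewrite ltnNge -(card_imset _ (@perm_inj _ (p^-1)%g)) subset_leq_card //.
apply/subsetP=> x /imsetP[a]; rewrite !inE => lt_a ->.
have := nest0 a; rewrite !inE lt_a /= => /negbT nlt.
have : (p^-1)%g a != b by apply: contraTneq lt_a => <-; rewrite permKV dltxx.
by case/(dlt_total c)/orP=> // lt_b'; rewrite lt_b' in nlt.
Qed.

(** The middle entry of a counted triple determines the other two. *)
Lemma ucross_dcross s b : ucross b s = dcross false s b.
Proof.
rewrite /ucross /dcross.
rewrite -(@card_in_imset _ _ (fun x : 'I_N * 'I_N * 'I_N => x.1.2)).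
  apply: eq_card => a; rewrite !inE /dlt; apply/imsetP/and3P.
    case=> [[[i k] l]]; rewrite inE /= => /and5P[ib bk kl /eqP Ek /eqP El] ->.
    by split; rewrite -?El // Ek permK.
  case=> lt1 lt2 lt3; exists ((s^-1)%g a, a, s b) => //.
  by rewrite inE permKV lt1 lt2 lt3 !eqxx.
move=> [[i k] l] [[i' k'] l']; rewrite !inE /=.
move=> /and5P[_ _ _ /eqP-> /eqP->] /and5P[_ _ _ /eqP-> /eqP->].
by move/perm_inj->.
Qed.

Lemma unest_dnest s b : (b < s b)%N -> unest b s = dnest false s b.
Proof.
move=> lt_b; rewrite /unest /dnest.
rewrite -(@card_in_imset _ _ (fun x : 'I_N * 'I_N * 'I_N => x.2)).
  apply: eq_card => a; rewrite !inE /dlt; apply/imsetP/andP.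
    case=> [[[i k] l]]; rewrite inE /= => /and5P[ib bk kl /eqP Ek /eqP Dl] ->.
    by split; rewrite -?Ek // Dl permK.
  case=> lt1 lt2; exists ((s^-1)%g a, s b, a) => //.
  by rewrite inE permKV lt1 lt2 lt_b !eqxx.
move=> [[i k] l] [[i' k'] l']; rewrite !inE /=.
move=> /and5P[_ _ _ /eqP-> /eqP->] /and5P[_ _ _ /eqP-> /eqP->].
by move/perm_inj->.
Qed.

Lemma lcross_dcross s b : lcross b s = dcross true s b.
Proof.
rewrite /lcross /dcross.
rewrite -(@card_in_imset _ _ (fun x : 'I_N * 'I_N * 'I_N => x.1.2)).
  apply: eq_card => a; rewrite !inE /dlt; apply/imsetP/and3P.
    case=> [[[i k] l]]; rewrite inE /= => /and5P[ik kb bl /eqP Ei /eqP Dk] ->.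
    by split; rewrite -?Ei // Dk permK.
  case=> lt1 lt2 lt3; exists (s b, a, (s^-1)%g a) => //.
  by rewrite inE permKV lt1 lt2 lt3 !eqxx.
move=> [[i k] l] [[i' k'] l']; rewrite !inE /=.
move=> /and5P[_ _ _ /eqP-> /eqP->] /and5P[_ _ _ /eqP-> /eqP->].
by move/perm_inj->.
Qed.

Lemma lnest_dnest s b : (s b < b)%N -> lnest b s = dnest true s b.
Proof.
move=> lt_b; rewrite /lnest /dnest.
rewrite -(@card_in_imset _ _ (fun x : 'I_N * 'I_N * 'I_N => x.1.1)).
  apply: eq_card => a; rewrite !inE /dlt; apply/imsetP/andP.
    case=> [[[i k] l]]; rewrite inE /= => /and5P[ik kb bl /eqP Di /eqP Ek] ->.
    by split; rewrite -?Ek // Di permK.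
  case=> lt1 lt2; exists (a, s b, (s^-1)%g a) => //.
  by rewrite inE permKV lt1 lt2 lt_b !eqxx.
move=> [[i k] l] [[i' k'] l']; rewrite !inE /=.
move=> /and5P[_ _ _ /eqP-> /eqP->] /and5P[_ _ _ /eqP-> /eqP->].
by move/perm_inj->.
Qed.

Lemma eq_perm_inv s (i j : 'I_N) : (i == s j) = (j == (s^-1)%g i).
Proof. by rewrite -(inj_eq (@perm_inj _ s) j) permKV eq_sym. Qed.

(** Inversion reverses every arc, which exchanges the two sides of the diagonal. *)
Lemma ucross'_inv s b : ucross' b s = lcross b (s^-1)%g.
Proof.
apply: eq_card => -[[i j] l]; rewrite !inE.
by rewrite ![_ == s _]eq_perm_inv.
Qed.

Lemma unest'_inv s b : unest' b s = lnest b (s^-1)%g.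
Proof.
apply: eq_card => -[[i j] l]; rewrite !inE.
by rewrite ![_ == s _]eq_perm_inv [(j == _) && _]andbC.
Qed.

Lemma lcross'_inv s b : lcross' b s = ucross b (s^-1)%g.
Proof.
apply: eq_card => -[[i j] l]; rewrite !inE.
by rewrite ![_ == s _]eq_perm_inv.
Qed.

Lemma lnest'_inv s b : lnest' b s = unest b (s^-1)%g.
Proof.
apply: eq_card => -[[i j] l]; rewrite !inE.
by rewrite ![_ == s _]eq_perm_inv [(l == _) && _]andbC.
Qed.

End Records.

(** * Open arcs at each index *)

Section LocalCounts.

Variables (N : nat) (s : 'S_N).
Hypothesis Ds : Dperm s.
Let t := word_of s.

Lemma board_word e b :
  cls t e b = side (if e then s^-1 else s)%g b /\
  tgt t e b = omap negb (side (if e then s^-1 else s)^-1%g b).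
Proof. by apply/(boardP (cls_tgtN t e)); rewrite perm_boardP Ds eqxx. Qed.

Lemma dcut_turns e c b : dcut c (if e then s^-1 else s)%g b =
  (turns t c (fun a => dlt c a b) - turns t (~~ c) (fun a => dlt c a b))%N.
Proof.
rewrite dcutE -(card_classes t e c (fun a => dlt c a b)).
congr (_ - _)%N; apply: eq_card => a; rewrite !inE andbC; congr (_ && _).
  have [_ ->] := board_word e a; rewrite -dlt_neg.
  apply/(sameP (sideP _ _ _)); case: (side _ _) => [c'|] /=; last by constructor.
  by apply: (iffP eqP) => [[<-]|[->]]; rewrite negbK.
have [-> _] := board_word e a.
by apply/(sameP (sideP _ _ _))/eqP.
Qed.

Lemma arcs_at_nonfix e c b : cls t e b = Some c ->
  arcs_at t b = (dnest c (if e then s^-1 else s)%g b +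
                 dcross c (if e then s^-1 else s)%g b).+1.
Proof.
move=> clsb; rewrite -dnest_dcross; last first.
  by apply/sideP; have [<- _] := board_word e b.
have := board_roomE e b (word_of_balanced Ds).
rewrite /board_room clsb (card_classes t e c (fun a => dlt c a b)) -(dcut_turns e c b).
move->; rewrite /choices; case tb: (tnth _ b) => [x|] //.
by move: clsb; rewrite /cls tb; case: (e).
Qed.

Section FixedPoint.

Variable b : 'I_N.
Hypothesis sb : s b = b.

(** As many arcs pass above a fixed point as below it, so it is a record exactly when it is an
    antirecord. *)
Let arcs_cut e : arcs_at t b = dcut true (if e then s^-1 else s)%g b.
Proof.
by rewrite dcut_turns /arcs_at tnth_mktuple /letter_of sb eqxx.
Qed.

Lemma psnest_fix : psnest b s = arcs_at t b.
Proof.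
rewrite (arcs_cut true); apply: eq_card => i; rewrite !inE /dlt invgK.
case: ltnP => //= lt_i; rewrite -leqNgt ltn_neqAle andb_idl // => _.
apply: contraTneq lt_i => /val_inj; rewrite -{1}sb => /perm_inj<-.
by rewrite ltnn.
Qed.

Lemma antirecord_fix : antirecord s b = (arcs_at t b == 0%N).
Proof.
rewrite (arcs_cut false) antirecord_dnest; congr (_ == _); apply: eq_card => a.
rewrite !inE /dlt sb; case: ltnP => //= lt_a.
rewrite -leqNgt ltn_neqAle andb_idl // => _.
apply: contraTneq lt_a => /val_inj eb.
by rewrite -(permKV s a) -eb sb ltnn.
Qed.

Lemma record_fix : record s b = (arcs_at t b == 0%N).
Proof.
rewrite -psnest_fix record_dnest /dnest /psnest; congr (_ == _).
rewrite -(card_imset _ (@perm_inj _ (s^-1)%g)); apply: eq_card => i.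
rewrite !inE /dlt; apply/imsetP/andP=> [[a]|[lt_i lt_b]].
  by rewrite inE sb => /andP[ba ab] ->; rewrite permKV.
by exists (s i); rewrite ?inE permK // sb lt_i lt_b.
Qed.

End FixedPoint.

Lemma letter_classes b (o := oddidx b) (l := letter_of s b) :
  [/\ cpeak s b = (l == Some true) && ~~ o, cval s b = (l == Some true) && o,
      cdfall s b = (l == Some false) && ~~ o,
      cdrise s b = (l == Some false) && o & fixpt s b = (l == None)].
Proof.
have /word_ofP/(_ b) : Dperm s && (word_of s == word_of s) by rewrite Ds eqxx.
rewrite tnth_mktuple -/o -/l /side /cpeak /cval /cdfall /cdrise /fixpt.
rewrite -val_eqE /=.
by case: (ltngtP (s b) b); case: (ltngtP ((s^-1)%g b) b);
   case: o l => [] [[]|] //= ? ? [].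
Qed.

End LocalCounts.

(** * Local weights *)

Section ArcWeights.

Variables (R : comNzRingType) (p q x u : R).

(* The weight of the choice that leaves r of the k open arcs nested and the
   others crossed; it is a record exactly when r = 0. *)
Definition arc_weight (k r : nat) : R :=
  (if r == 0%N then x else u) * (p ^+ (k.-1 - r) * q ^+ r).

Lemma sum_arc_weight k : \sum_(r < k.+1) arc_weight k.+1 r =
  p ^+ k * x + q * pqint k p q * u.
Proof.
rewrite big_ord_recl /arc_weight /= subn0 expr0 mulr1 mulrC; congr (_ + _).
(* [pqint] is indexed by the exponent of [p], the crossings, hence the reversal. *)
rewrite /pqint big_distrr big_distrl /= (reindex_inj rev_ord_inj) /=.
apply: eq_bigr => j _; have := ltn_ord j.
rewrite /bump /= add1n => ltjk.
have -> : (k - (k - j.+1).+1 = j)%N by lia.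
have -> : (k.-1 - j = k - j.+1)%N by lia.
by rewrite exprS; ring.
Qed.

End ArcWeights.

Lemma expr_card_set (R : comNzRingType) (T : finType) (x : R) (A : pred T) :
  x ^+ #|[set a | A a]| = \prod_a x ^+ (A a).
Proof. by rewrite card_set_sum expr_sum. Qed.

Lemma expr_sum_cond (R : comNzRingType) (T : finType) (x : R) (A : pred T) m :
  x ^+ (\sum_(a | A a) m a)%N = \prod_a x ^+ (A a * m a).
Proof.
rewrite expr_sum big_mkcond; apply: eq_bigr => a _.
by case: (A a); rewrite ?mul1n ?mul0n ?expr0.
Qed.

Lemma letter_of_fix N (s : 'S_N) b : letter_of s b = None -> s b = b.
Proof. by rewrite /letter_of; case: eqP. Qed.

Lemma cls_letter N (s : 'S_N) e b :
  cls (word_of s) e b =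
  (if e then inv_side_letter else side_letter) (oddidx b) (letter_of s b).
Proof. by rewrite /cls tnth_mktuple. Qed.

Section LocalWeights.

Variables (R : comNzRingType).
Variables (x1 x2 y1 y2 u1 u2 v1 v2 we wo ze zo : R).
Variables (pm1 pm2 pp1 pp2 qm1 qm2 qp1 qp2 se so : R).

(** A fixed point under no arc is a record-antirecord; under [k > 0] arcs it is neither, and its
    [psnest] is [k]. *)
Definition local_weight (o : bool) (l : letter) (k r : nat) : R :=
  match l with
  | None => if k == 0%N then if o then zo else ze
            else if o then so ^+ k * wo else se ^+ k * we
  | Some true =>
      if o then arc_weight pp1 qp1 y1 v1 k r else arc_weight pm1 qm1 x1 u1 k r
  | Some false =>
      if o then arc_weight pp2 qp2 y2 v2 k r else arc_weight pm2 qm2 x2 u2 k r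
  end.

Lemma sum_Dperm N :
  \sum_(s : 'S_N | Dperm s)
    (x1 ^+ eareccpeak s * x2 ^+ eareccdfall s *
     y1 ^+ ereccval s * y2 ^+ ereccdrise s *
     u1 ^+ nrcpeak s * u2 ^+ nrcdfall s *
     v1 ^+ nrcval s * v2 ^+ nrcdrise s *
     we ^+ evennrfix s * wo ^+ oddnrfix s *
     ze ^+ evenrar s * zo ^+ oddrar s *
     pm1 ^+ lcrosscpeak s * pm2 ^+ lcrosscdfall s *
     pp1 ^+ ucrosscval s * pp2 ^+ ucrosscdrise s *
     qm1 ^+ lnestcpeak s * qm2 ^+ lnestcdfall s *
     qp1 ^+ unestcval s * qp2 ^+ unestcdrise s *
     se ^+ epsnest s * so ^+ opsnest s) =
  heights_sum local_weight true 0 N.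
Proof.
rewrite -sum_balanced_words; apply: (@sum_Dperm_words _ _ _ false) => s Ds.
rewrite /eareccpeak /eareccdfall /ereccval /ereccdrise /nrcpeak /nrcdfall.
rewrite /nrcval /nrcdrise /evennrfix /oddnrfix /evenrar /oddrar.
rewrite !expr_card_set !expr_sum_cond -!big_split /=.
apply: eq_bigr => b _; have [-> -> -> -> ->] := letter_classes Ds b.
rewrite -[evenidx b]/(~~ oddidx b) /board_rank /local_weight /earec /erec /nrar /rar.
case lb: (letter_of s b) => [x|]; last first.
  have sb := letter_of_fix lb.
  rewrite (psnest_fix Ds sb) (record_fix Ds sb) (antirecord_fix Ds sb).
  rewrite /= !mul0n !expr0; case: (oddidx b); case: eqP => [->|_] /=;
  by rewrite ?mul0n ?mul1n ?expr0 ?expr1 ?mulr1 ?mul1r // mulrC.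
have clsb : cls (word_of s) false b = Some (~~ oddidx b).
  by rewrite cls_letter lb.
have lt_b : dlt (~~ oddidx b) (s b) b.
  by apply/sideP; have [<- _] := board_word Ds false b.
(* The records of the opposite kind are excluded here, so exclusiveness is automatic at a moved
   index. *)
have nest0 : dnest (oddidx b) s b != 0%N.
  by apply: dnest_neq0; rewrite -dlt_neg.
rewrite clsb (arcs_at_nonfix Ds clsb) /arc_weight /= addKn.
rewrite record_dnest antirecord_dnest ucross_dcross lcross_dcross.
case: (oddidx b) lt_b nest0 => /= lt_b /negbTE nest0; rewrite nest0.
  rewrite (unest_dnest lt_b); case: x lb => _; case: eqP => _ /=;
  by rewrite ?mul0n ?mul1n ?expr0 ?expr1 ?mulr1 ?mul1r mulrA.
rewrite (lnest_dnest lt_b); case: x lb => _; case: eqP => _ /=;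
by rewrite ?mul0n ?mul1n ?expr0 ?expr1 ?mulr1 ?mul1r mulrA.
Qed.

Lemma sum_Dperm' N :
  \sum_(s : 'S_N | Dperm s)
    (x1 ^+ ereccpeak' s * x2 ^+ eareccdfall' s *
     y1 ^+ eareccval' s * y2 ^+ ereccdrise' s *
     u1 ^+ nrcpeak' s * u2 ^+ nrcdfall' s *
     v1 ^+ nrcval' s * v2 ^+ nrcdrise' s *
     we ^+ evennrfix s * wo ^+ oddnrfix s *
     ze ^+ evenrar s * zo ^+ oddrar s *
     pm1 ^+ ucrosscpeak' s * pm2 ^+ lcrosscdfall' s *
     pp1 ^+ lcrosscval' s * pp2 ^+ ucrosscdrise' s *
     qm1 ^+ unestcpeak' s * qm2 ^+ lnestcdfall' s *
     qp1 ^+ lnestcval' s * qp2 ^+ unestcdrise' s *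
     se ^+ epsnest s * so ^+ opsnest s) =
  heights_sum local_weight true 0 N.
Proof.
rewrite -sum_balanced_words; apply: (@sum_Dperm_words _ _ _ true) => s Ds.
rewrite /ereccpeak' /eareccdfall' /eareccval' /ereccdrise' /nrcpeak' /nrcdfall'.
rewrite /nrcval' /nrcdrise' /evennrfix /oddnrfix /evenrar /oddrar.
rewrite !expr_card_set !expr_sum_cond -!big_split /=.
apply: eq_bigr => b _; have [-> -> -> -> ->] := letter_classes Ds b.
rewrite -[evenidx b]/(~~ oddidx b) /board_rank /local_weight.
case lb: (letter_of s b) => [x|]; last first.
  have sb := letter_of_fix lb.
  rewrite /nrar /rar (psnest_fix Ds sb) (record_fix Ds sb) (antirecord_fix Ds sb).
  rewrite /= !mul0n !expr0; case: (oddidx b); case: eqP => [->|_] /=;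
  by rewrite ?mul0n ?mul1n ?expr0 ?expr1 ?mulr1 ?mul1r // mulrC.
(* The primed records are read at the preimage of [b], but [evenrar] and [oddrar] still test [b]
   itself. *)
have rarF : rar s b = false.
  have lt_b : dlt (oddidx b) b (s b).
    rewrite -dlt_neg; apply/sideP; have [<- _] := board_word Ds false b.
    by rewrite cls_letter lb.
  rewrite /rar record_dnest antirecord_dnest.
  by case: (oddidx b) lt_b => /dnest_neq0/negbTE->; rewrite ?andbF.
pose c := if x then ~~ oddidx b else oddidx b.
have clsb : cls (word_of s) true b = Some c by rewrite cls_letter lb.
have lt_b : dlt c ((s^-1)%g b) b.
  by apply/sideP; have [<- _] := board_word Ds true b.
rewrite rarF clsb (arcs_at_nonfix Ds clsb) /arc_weight /= addKn.
rewrite record_inv antirecord_inv ucross'_inv lcross'_inv unest'_inv lnest'_inv.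
rewrite record_dnest antirecord_dnest ucross_dcross lcross_dcross.
rewrite /c {c clsb} in lt_b *.
case: (oddidx b) lt_b => /= lt_b; case: x lb lt_b => /= _ lt_b;
  rewrite ?(unest_dnest lt_b) ?(lnest_dnest lt_b); case: eqP => _ /=;
  by rewrite ?andbF ?mul0n ?mul1n ?expr0 ?expr1 ?mulr1 ?mul1r mulrA.
Qed.

Let lsum := letter_sum local_weight.

Lemma letter_sum_fix o k : lsum o None k = local_weight o None k 0.
Proof. by rewrite /lsum /letter_sum big_ord1. Qed.

Lemma letter_sum0 o turn : lsum o (Some turn) 0 = 0.
Proof. by rewrite /lsum /letter_sum big_ord0. Qed.

(* Steps of the paths in which height h is drawn at level 2h before an odd index
   and at level 2h-1 before an even one. *)
Definition rise (H : nat) : R :=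
  if odd H then lsum false (Some false) H./2.+1 + lsum false None H./2.+1
  else lsum true (Some true) H./2.+1.

Definition fall (H : nat) : R :=
  if odd H then lsum false (Some true) H./2.+1
  else lsum true (Some false) H./2 + lsum true None H./2.

Lemma rise_fall_even k : rise k.*2 * fall k.*2.+1 =
  (pm1 ^+ k * x1 + qm1 * pqint k pm1 qm1 * u1) *
  (pp1 ^+ k * y1 + qp1 * pqint k pp1 qp1 * v1).
Proof.
rewrite /rise /fall /= odd_double /= uphalf_double doubleK.
by rewrite /lsum /letter_sum /= !sum_arc_weight mulrC.
Qed.

(** With [k.+1] open arcs, the rise is a double fall or fixed point at an even index, the fall a
    double rise or fixed point at an odd one. *)
Lemma rise_fall_odd k : rise k.*2.+1 * fall k.*2.+2 =
  (pm2 ^+ k * x2 + qm2 * pqint k pm2 qm2 * u2 + se ^+ k.+1 * we) *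
  (pp2 ^+ k * y2 + qp2 * pqint k pp2 qp2 * v2 + so ^+ k.+1 * wo).
Proof.
rewrite /rise /fall /= odd_double /= uphalf_double doubleK !letter_sum_fix /=.
by rewrite /lsum /letter_sum /= !sum_arc_weight.
Qed.

Lemma heights_sum_tfrac (alpha delta : nat -> R) :
    (forall H, alpha H.+1 = rise H * fall H.+1) ->
    delta 1 = ze * zo -> (forall H, delta H.+2 = 0) ->
  is_tfrac alpha delta (fun n => heights_sum local_weight true 0 n.*2).
Proof.
move=> alphaE delta1 delta0.
have stepE o h m : heights_sum local_weight o h m.+1 =
    lsum o (Some true) (if o then h.+1 else h) *
      heights_sum local_weight (~~ o) (if o then h.+1 else h.-1) m +
    (lsum o (Some false) h + lsum o None h) *
      heights_sum local_weight (~~ o) h m by [].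
(* With no open arc, only an odd fixed point followed by an even one avoids a valley; this long
   level step has weight [ze * zo]. *)
apply: (is_tfrac_paths alphaE delta0
  (up := fun h n => heights_sum local_weight true h n.*2)
  (dn := fun h n => heights_sum local_weight false h n.*2.+1) delta1) => //.
- move=> h n; rewrite /rise odd_double doubleK doubleS.
  rewrite [LHS]stepE /negb; case: h => [|h] //.
    by rewrite letter_sum0 letter_sum_fix add0r.
  by rewrite /fall odd_double doubleK.
- move=> n; rewrite stepE !letter_sum0 letter_sum_fix.
  by rewrite mul0r !add0r.
by move=> h n; rewrite stepE /rise /fall /= odd_double /= uphalf_double.
Qed.

End LocalWeights.

(** * Specialization to the generating polynomials *)

Local Notation weight22 :=
  (local_weight x1 x2 y1 y2 u1 u2 v1 v2 we wo ze zo pm1 pm2 pp1 pp2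
                qm1 qm2 qp1 qp2 se so).

Lemma P_heights n : P n = heights_sum weight22 true 0 (2 * n).
Proof. exact: sum_Dperm. Qed.

Lemma P'_heights n : P' n = heights_sum weight22 true 0 (2 * n).
Proof. exact: sum_Dperm'. Qed.


Theorem theorem3p13 :
  is_tfrac alpha delta P' /\ (forall n : nat, P n = P' n).
Proof.
split=> [|n]; last by rewrite P_heights P'_heights.
have tfrac : is_tfrac alpha delta (fun n => heights_sum weight22 true 0 n.*2).
  apply: heights_sum_tfrac => // H.
  rewrite -(odd_double_half H); case: (odd H); rewrite ?add0n ?add1n.
    rewrite rise_fall_odd /alpha /= negbK odd_double /= ?uphalf_double ?doubleK.
    by [].
  rewrite rise_fall_even /alpha /= odd_double /= ?uphalf_double ?doubleK.
  by [].
move=> n; have [K0 tfracK] := tfrac n; exists K0 => K /tfracK ->.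
by rewrite P'_heights mul2n.
Qed.
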